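(* Every Lie $2$-group $G_1\rightrightarrows G_0$ with $G_1$ compact can be endowed with a bi-invariant $1$-metric.
   Context: A Lie $2$-group is a Lie groupoid $G_1\rightrightarrows G_0$ in which $G_1,G_0$ are Lie groups and all structure maps are Lie group homomorphisms. A $1$-metric on a Lie groupoid $X_1\rightrightarrows X_0$ with source $s$, target $t$ and inversion $i$ is a Riemannian metric $\eta^{(1)}$ on $X_1$ for which $i$ is an isometry and which is transverse to $s$ (hence also to $t$), i.e. there is a (unique) Riemannian metric $\eta^{(0)}=s_*\eta^{(1)}=t_*\eta^{(1)}$ on $X_0$ making $s$ and $t$ Riemannian submersions; one writes $\eta=(\eta^{(1)},\eta^{(0)})$. Let $L=(L^1,L^0)$ and $R=(R^1,R^0)$ be the $2$-actions of $G_1\rightrightarrows G_0$ on itself where $L^j$ and $R^j$ are the actions of $G_j$ on itself by left and right multiplications. A $1$-metric $\eta$ on $G_1\rightrightarrows G_0$ is bi-invariant if $L$ and $R$ are isometric for it, i.e. all left and right translations of $G_1$ are isometries of $(G_1,\eta^{(1)})$. The paper assumes throughout the part containing this statement that the Lie groups are connected. *)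

(* Defs.v *)
From HB Require Import structures.
From mathcomp Require Import all_boot all_order all_algebra.
From mathcomp Require Import all_classical all_reals all_analysis.

Set Implicit Arguments.
Unset Strict Implicit.
Unset Printing Implicit Defensive.

Import Order.TTheory GRing.Theory Num.Theory.
Import numFieldNormedType.Exports.

Local Open Scope classical_set_scope.
Local Open Scope ring_scope.

(* [Ck k U f]: f is of class C^k on the open set U. *)
Fixpoint Ck (R : realType) (V W : normedModType R) (k : nat) (U : set V)
    (f : V -> W) : Prop :=
  match k with
  | 0%N => forall x, U x -> {for x, continuous f}
  | k'.+1 => (forall x, U x -> differentiable f x) /\
             forall v : V, Ck k' U (fun x => 'd f x v)
  end.

Definition Cinfty (R : realType) (V W : normedModType R) (U : set V)
    (f : V -> W) : Prop :=
  forall k, Ck k U f.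

(* [chart_inv] is only meaningful on [chart_cod], and [chart_map] on
   [chart_dom]. *)
Record chart (R : realType) (n : nat) (M : Type) := Chart {
  chart_dom : set M;
  chart_map : M -> 'rV[R]_n;
  chart_inv : 'rV[R]_n -> M }.

Definition chart_cod (R : realType) (n : nat) (M : Type) (c : chart R n M) :
    set 'rV[R]_n :=
  chart_map c @` chart_dom c.

Definition is_chart (R : realType) (n : nat) (M : topologicalType)
    (c : chart R n M) : Prop :=
  [/\ open (chart_dom c),
      open (chart_cod c),
      forall p, chart_dom c p -> {for p, continuous (chart_map c)},
      forall x, chart_cod c x -> {for x, continuous (chart_inv c)} &
      forall p, chart_dom c p -> chart_inv c (chart_map c p) = p].

Definition prod_chart (R : realType) (m n : nat) (M N : Type)
    (c : chart R m M) (d : chart R n N) : chart R (m + n) (M * N) :=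
  Chart (chart_dom c `*` chart_dom d)
        (fun p => row_mx (chart_map c p.1) (chart_map d p.2))
        (fun x => (chart_inv c (lsubmx x), chart_inv d (rsubmx x))).

Definition prod_atlas (R : realType) (m n : nat) (M N : Type)
    (A : set (chart R m M)) (B : set (chart R n N)) :
    set (chart R (m + n) (M * N)) :=
  [set e | exists c d, [/\ A c, B d & e = prod_chart c d]].

(* The expression of f in the charts c and d; it represents f on
   [chart_map c @` (chart_dom c `&` f @^-1` chart_dom d)]. *)
Definition in_charts (R : realType) (m n : nat) (M N : Type)
    (c : chart R m M) (d : chart R n N) (f : M -> N) : 'rV[R]_m -> 'rV[R]_n :=
  chart_map d \o f \o chart_inv c.

(* Smoothness on an open set W, with respect to the smooth structures generated
   by the atlases A and B. *)
Definition smooth_on_open (R : realType) (m n : nat) (M N : topologicalType)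
    (A : set (chart R m M)) (B : set (chart R n N)) (W : set M) (f : M -> N) :
    Prop :=
  (forall p, W p -> {for p, continuous f}) /\
  forall c d, A c -> B d ->
    Cinfty (chart_map c @` (chart_dom c `&` W `&` f @^-1` chart_dom d))
           (in_charts c d f).

(* Smoothness of the restriction of f to an arbitrary subset S: f|S extends
   locally to smooth maps.  When S is an embedded submanifold this is
   smoothness for the induced manifold structure. *)
Definition smooth_on_subset (R : realType) (m n : nat) (M N : topologicalType)
    (A : set (chart R m M)) (B : set (chart R n N)) (S : set M) (f : M -> N) :
    Prop :=
  forall p, S p -> exists W F,
    [/\ open W, W p, smooth_on_open A B W F &
        forall q, W q -> S q -> F q = f q].

HB.mixin Record Topological_isManifold (R : realType) (n : nat) M
    of Topological M := {
  atlas : set (chart R n M);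
  atlas_is_chart : forall c, atlas c -> is_chart c;
  atlas_cover : forall p : M, exists2 c, atlas c & chart_dom c p;
  atlas_compatible : smooth_on_open atlas atlas setT (@id M);
  manifold_hausdorff : hausdorff_space M;
  manifold_second_countable : @second_countable M }.

#[short(type="manifoldType")]
HB.structure Definition Manifold (R : realType) (n : nat) :=
  { M of Topological M & Topological_isManifold R n M }.

Arguments atlas {R n} s : rename.

Definition smooth (R : realType) (m n : nat) (M : manifoldType R m)
    (N : manifoldType R n) (f : M -> N) : Prop :=
  smooth_on_open (atlas M) (atlas N) setT f.

HB.mixin Record Manifold_Group_isLieGroup (R : realType) (n : nat) G
    of Manifold R n G & Group G := {
  mulg_smooth : smooth_on_open (prod_atlas (atlas G) (atlas G)) (atlas G) setT
                  (fun p : G * G => (p.1 * p.2)%g);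
  invg_smooth : smooth_on_open (atlas G) (atlas G) setT
                  (fun g : G => (g^-1)%g) }.

#[short(type="lieGroupType")]
HB.structure Definition LieGroup (R : realType) (n : nat) :=
  { G of Manifold R n G & Group G & Manifold_Group_isLieGroup R n G }.

Definition chart_at (R : realType) (n : nat) (M : manifoldType R n) (p : M) :
    set (chart R n M) :=
  [set c | atlas M c /\ chart_dom c p].

(* The differential of f at p, on the coordinates in c of tangent vectors at p,
   with values in the coordinates in d of tangent vectors at f p. *)
Definition tangent_map (R : realType) (m n : nat) (M N : Type)
    (c : chart R m M) (d : chart R n N) (f : M -> N) (p : M) :
    'rV[R]_m -> 'rV[R]_n :=
  'd (in_charts c d f) (chart_map c p).

Definition submersion (R : realType) (m n : nat) (M : manifoldType R m)
    (N : manifoldType R n) (f : M -> N) : Prop :=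
  smooth f /\
  forall p c d, chart_at p c -> chart_at (f p) d ->
    forall w, exists v, tangent_map c d f p v = w.

Definition diffeomorphism (R : realType) (m n : nat) (M : manifoldType R m)
    (N : manifoldType R n) (f : M -> N) : Prop :=
  smooth f /\ exists f', [/\ smooth f', cancel f f' & cancel f' f].

(* A field of bilinear forms on the tangent spaces, given by its Gram matrices
   in the coordinates of each chart. *)
Definition gram_field (R : realType) (n : nat) (M : Type) : Type :=
  chart R n M -> M -> 'M[R]_n.

Definition inner (R : realType) (n : nat) (M : Type) (g : gram_field R n M)
    (c : chart R n M) (p : M) (v w : 'rV[R]_n) : R :=
  (v *m g c p *m w^T) ord0 ord0.

Definition preserves_inner (R : realType) (m n : nat) (M : manifoldType R m)
    (N : manifoldType R n) (g : gram_field R m M) (h : gram_field R n N)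
    (f : M -> N) : Prop :=
  forall p c d, chart_at p c -> chart_at (f p) d ->
    forall v w, inner g c p v w =
      inner h d (f p) (tangent_map c d f p v) (tangent_map c d f p w).

(* For [id], [preserves_inner] is the law of transformation of a covariant
   2-tensor under changes of charts. *)
Record riemannianMetric (R : realType) (n : nat) (M : manifoldType R n) :=
  RiemannianMetric {
  gram :> gram_field R n M;
  gram_change_of_chart : preserves_inner gram gram id;
  gram_sym : forall p c, chart_at p c ->
    forall v w, inner gram c p v w = inner gram c p w v;
  gram_posdef : forall p c, chart_at p c ->
    forall v, v != 0 -> 0 < inner gram c p v v;
  gram_smooth : forall c, atlas M c ->
    Cinfty (chart_cod c) (fun x => gram c (chart_inv c x)) }.

Definition isometry (R : realType) (m n : nat) (M : manifoldType R m)
    (N : manifoldType R n) (g : riemannianMetric M) (h : riemannianMetric N)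
    (f : M -> N) : Prop :=
  diffeomorphism f /\ preserves_inner g h f.

Definition horizontal (R : realType) (m n : nat) (M : Type) (N : Type)
    (g : gram_field R m M) (c : chart R m M) (d : chart R n N) (f : M -> N)
    (p : M) (v : 'rV[R]_m) : Prop :=
  forall k, tangent_map c d f p k = 0 -> inner g c p v k = 0.

Definition riemannian_submersion (R : realType) (m n : nat)
    (M : manifoldType R m) (N : manifoldType R n)
    (g : riemannianMetric M) (h : riemannianMetric N) (f : M -> N) : Prop :=
  submersion f /\
  forall p c d, chart_at p c -> chart_at (f p) d ->
    forall v w, horizontal g c d f p v -> horizontal g c d f p w ->
      inner g c p v w =
      inner h d (f p) (tangent_map c d f p v) (tangent_map c d f p w).

Definition composable (X1 X0 : Type) (s t : X1 -> X0) : set (X1 * X1) :=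
  [set p | s p.1 = t p.2].

(* [lg_comp g h] is the composite of h followed by g; it is only meaningful
   when [lg_src g = lg_tgt h]. *)
Record lieGroupoid (R : realType) (n1 n0 : nat) (X1 : manifoldType R n1)
    (X0 : manifoldType R n0) := LieGroupoid {
  lg_src : X1 -> X0;
  lg_tgt : X1 -> X0;
  lg_unit : X0 -> X1;
  lg_inv : X1 -> X1;
  lg_comp : X1 -> X1 -> X1;
  lg_src_unit : forall x, lg_src (lg_unit x) = x;
  lg_tgt_unit : forall x, lg_tgt (lg_unit x) = x;
  lg_src_inv : forall g, lg_src (lg_inv g) = lg_tgt g;
  lg_tgt_inv : forall g, lg_tgt (lg_inv g) = lg_src g;
  lg_src_comp : forall g h, lg_src g = lg_tgt h ->
    lg_src (lg_comp g h) = lg_src h;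
  lg_tgt_comp : forall g h, lg_src g = lg_tgt h ->
    lg_tgt (lg_comp g h) = lg_tgt g;
  lg_compA : forall g h k, lg_src g = lg_tgt h -> lg_src h = lg_tgt k ->
    lg_comp g (lg_comp h k) = lg_comp (lg_comp g h) k;
  lg_unit_comp : forall g, lg_comp (lg_unit (lg_tgt g)) g = g;
  lg_comp_unit : forall g, lg_comp g (lg_unit (lg_src g)) = g;
  lg_comp_inv : forall g, lg_comp g (lg_inv g) = lg_unit (lg_tgt g);
  lg_inv_comp : forall g, lg_comp (lg_inv g) g = lg_unit (lg_src g);
  lg_src_submersion : submersion lg_src;
  lg_tgt_submersion : submersion lg_tgt;
  lg_unit_smooth : smooth lg_unit;
  lg_inv_smooth : smooth lg_inv;
  lg_comp_smooth :
    smooth_on_subset (prod_atlas (atlas X1) (atlas X1)) (atlas X1)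
      (composable lg_src lg_tgt) (fun p => lg_comp p.1 p.2) }.

Record lie2Group (R : realType) (n1 n0 : nat) (G1 : lieGroupType R n1)
    (G0 : lieGroupType R n0) := Lie2Group {
  l2_groupoid :> lieGroupoid G1 G0;
  l2_srcM : {morph lg_src l2_groupoid : g h / (g * h)%g};
  l2_tgtM : {morph lg_tgt l2_groupoid : g h / (g * h)%g};
  l2_unitM : {morph lg_unit l2_groupoid : x y / (x * y)%g};
  l2_invM : {morph lg_inv l2_groupoid : g h / (g * h)%g};
  l2_compM : forall g g' h h',
    lg_src l2_groupoid g = lg_tgt l2_groupoid h ->
    lg_src l2_groupoid g' = lg_tgt l2_groupoid h' ->
    lg_comp l2_groupoid (g * g')%g (h * h')%g =
      (lg_comp l2_groupoid g h * lg_comp l2_groupoid g' h')%g }.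

Record oneMetric (R : realType) (n1 n0 : nat) (X1 : manifoldType R n1)
    (X0 : manifoldType R n0) (X : lieGroupoid X1 X0) := OneMetric {
  eta1 : riemannianMetric X1;
  eta0 : riemannianMetric X0;
  eta1_inv : isometry eta1 eta1 (lg_inv X);
  eta1_src : riemannian_submersion eta1 eta0 (lg_src X);
  eta1_tgt : riemannian_submersion eta1 eta0 (lg_tgt X) }.

Definition bi_invariant (R : realType) (n1 n0 : nat) (G1 : lieGroupType R n1)
    (G0 : lieGroupType R n0) (X : lie2Group G1 G0) (eta : oneMetric X) : Prop :=
  (forall g : G1, isometry (eta1 eta) (eta1 eta) (fun h : G1 => (g * h)%g)) /\
  (forall g : G1, isometry (eta1 eta) (eta1 eta) (fun h : G1 => (h * g)%g)).

(* Main.v *)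
Require Import Defs.
From HB Require Import structures.
From mathcomp Require Import all_boot all_order all_algebra.
From mathcomp Require Import all_classical all_reals all_analysis.
From mathcomp Require Import ring lra.

(** Since [t = s o i], a bi-invariant metric on [G1] that is preserved by the
    inversion [i] of the groupoid and that is pushed forward to [G0] by [s] is
    also pushed forward, to the same metric, by [t].  So the task is to find an
    inner product [B] on the Lie algebra of [G1] that is invariant under the
    adjoint action and under [d_e i], and to let [s] push the metric forward.

    The inner product.  The maps [h |-> g (i^b h) g^-1], for [g] in [G1] and [b]
    a boolean, are closed under composition, because [i] is an involutive
    automorphism, so their differentials at [1] form a group of matrices; as
    these depend continuously on [g] and [G1] is compact, the group is bounded.
    A bounded group [H] of matrices fixes an inner product
    ([exists_invariant_form]): minimize [S |-> sup_(h in H) |h S h^T|^2] over a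
    convex set of inner products that [H] preserves.  By the parallelogram
    identity, almost minimizers lie close to each other, so that minimizing
    sequences are Cauchy; as the objective is [H]-invariant, an almost minimizer
    also lies close to its translates, and the limit of a minimizing sequence is
    fixed by [H].

    The metric on [G1] is the left-invariant metric that extends [B]; its
    invariance under right translations and under [i] is the invariance of [B].
    In charts, a left-invariant metric is computed from the Maurer-Cartan form
    [maurer_cartan], and all its symmetries come from a single remark: if
    [f p]^-1 [f h] = [phi (p^-1 h)] for all [h], then [f] acts on the
    Maurer-Cartan form at [p] through the differential of [phi] at [1]
    ([tangent_maurer_cartan]).

    The metric on [G0].  The differential of [s] at [1] is surjective, hence
    there is a unique inner product on the Lie algebra of [G0] for which it is
    isometric on the orthogonal complement of its kernel
    ([exists_quotient_form]).  As [s] is a homomorphism, the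
    corresponding left-invariant metric makes [s] a Riemannian submersion
    at every point ([left_metric_submersion]). *)

Set Implicit Arguments.
Unset Strict Implicit.
Unset Printing Implicit Defensive.

Import Order.TTheory GRing.Theory Num.Theory.
Import numFieldNormedType.Exports.

Local Open Scope classical_set_scope.
Local Open Scope ring_scope.

(** * Functions of class C^k on open sets of normed modules *)

Section Calculus.
Variables (R : realType) (V W : normedModType R).
Implicit Types (U : set V) (f g : V -> W) (k : nat).

(** Differentials only depend on germs.  This is immediate from the definition
    for a function that vanishes near [x], and [is_diff_near] reduces to that
    case by writing [g = f + (g - f)]. *)
Lemma is_diff_near0 f (x : V) : (\forall y \near x, f y = 0) -> is_diff x f 0.
Proof.
move=> f0.
have fx : f x = 0 by exact: nbhs_singleton f0.
have f0s : \forall y \near 0, f (y + x) = 0.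
  by move: f0; rewrite (near_shift 0) subr0.
have e : f \o shift x = cst (f x) + (0 : V -> W) +o_ 0 id.
  apply/eqaddoP => _/posnumP[e]; near=> y.
  have -> : (f \o shift x - (cst (f x) + (0 : V -> W))) y = f (y + x).
    by rewrite !fctE fx addr0 subr0.
  by rewrite (near f0s) ?normr0.
have d0 : 'd f x = (0 : V -> W) :> (V -> W).
  apply: (@diff_unique _ _ _ f (\0 : {linear V -> W})) => //.
  by move=> y; exact: cvg_cst.
apply: DiffDef => //; apply/diff_locallyP; split; rewrite d0//.
by move=> y; exact: cvg_cst.
Unshelve. all: by end_near. Qed.

Lemma is_diff_near f g (x : V) :
  (\forall y \near x, f y = g y) -> differentiable f x ->
  differentiable g x /\ 'd g x = 'd f x :> (V -> W).
Proof.
move=> fg /differentiableP df.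
have h0 : is_diff x (g - f) 0.
  by apply: is_diff_near0; apply: filterS fg => y e; rewrite !fctE e subrr.
have -> : g = f + (g - f) by apply/funext => y; rewrite !fctE addrC subrK.
have h := is_diffD df h0.
split; first exact: (@ex_diff _ _ _ _ _ _ _ h).
by rewrite (@diff_val _ _ _ _ _ _ _ h) addr0.
Qed.

Lemma Ck_sub k U U' f : U' `<=` U -> Ck k U f -> Ck k U' f.
Proof.
elim: k f => [|k IH] f sub /=; first by move=> h x /sub; exact: h.
by case=> d h; split=> [x /sub/d//|v]; exact: IH.
Qed.

(** [Ck] only constrains values and differentials pointwise, so it holds on a
    union as soon as it holds on the pieces; this is what allows a chart to be
    chosen around each point separately. *)
Lemma Ck_local k U f :
  (forall x, U x -> exists2 U', U' x & Ck k U' f) -> Ck k U f.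
Proof.
elim: k f => [|k IH] f h /=; first by move=> x /h[U' ? ]; apply.
split=> [x /h[U' U'x [d _]]|v]; first exact: d.
by apply: IH => x /h[U' U'x [_ /(_ v)]]; exists U'.
Qed.

Lemma Ck_eq k U f g : open U -> (forall x, U x -> f x = g x) ->
  Ck k U f -> Ck k U g.
Proof.
move=> Uo; elim: k f g => [|k IH] f g fg /=.
  move=> h x Ux; have fgx : \forall y \near x, f y = g y.
    by apply: filterS (open_nbhs_nbhs (conj Uo Ux)) => y /fg.
  apply: cvg_trans (_ : f @ x --> g x); first exact: near_eq_cvg.
  by rewrite -fg//; exact: h.
case=> d h.
have fgx x : U x -> differentiable g x /\ 'd g x = 'd f x :> (V -> W).
  move=> Ux; apply: is_diff_near; last exact: d.
  by apply: filterS (open_nbhs_nbhs (conj Uo Ux)) => y /fg.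
split=> [x /fgx[]//|v].
by apply: IH (h v) => x /fgx[_ ->].
Qed.

Lemma CkW k U f : Ck k.+1 U f -> Ck k U f.
Proof.
elim: k f => [|k IH] f.
  by case=> d _ x Ux; exact/differentiable_continuous/d.
by case=> d h; split=> // v; exact: IH.
Qed.

Lemma Ck_cst k U (a : W) : Ck k U (cst a).
Proof.
elim: k a => [|k IH] a /=; first by move=> x _; exact: cvg_cst.
split=> [x _|v]; first exact: differentiable_cst.
have -> : (fun x : V => 'd (cst a) x v) = cst 0.
  by apply/funext => x; rewrite diff_cst.
exact: IH.
Qed.

Lemma CkD k U f g : open U -> Ck k U f -> Ck k U g -> Ck k U (f + g).
Proof.
move=> Uo; elim: k f g => [|k IH] f g /=.
  by move=> hf hg x Ux; apply: continuousD; [exact: hf|exact: hg].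
case=> df hf [dg hg]; split=> [x Ux|v].
  by apply: differentiableD; [exact: df|exact: dg].
apply: Ck_eq (IH _ _ (hf v) (hg v)) => // x Ux.
by rewrite diffD//; [exact: df|exact: dg].
Qed.

Lemma Ck_sum k U (I : Type) (r : seq I) (P : pred I) (F : I -> V -> W) :
  open U -> (forall i, Ck k U (F i)) ->
  Ck k U (fun x => \sum_(i <- r | P i) F i x).
Proof.
move=> Uo h.
have -> : (fun x => \sum_(i <- r | P i) F i x) = \sum_(i <- r | P i) F i.
  by apply/funext => x; rewrite fct_sumE.
apply: big_ind => [|f g|i _]; [exact: Ck_cst|exact: CkD|exact: h].
Qed.

Lemma Ck_linear k U (L : {linear V -> W}) : continuous L -> Ck k U L.
Proof.
move=> Lc; case: k => [|k] /=; first by move=> x _; exact: Lc.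
split=> [x _|v]; first exact: linear_differentiable.
have -> : (fun x : V => 'd L x v) = cst (L v).
  by apply/funext => x; rewrite diff_lin.
exact: Ck_cst.
Qed.

Lemma Ck_scalel k U (a : V -> R) (w : W) : open U ->
  Ck k U a -> Ck k U (fun x => a x *: w).
Proof.
move=> Uo; elim: k a => [|k IH] a /=.
  move=> h x Ux; apply: (@continuousZr_tmp _ W); exact: h.
case=> d h; split=> [x Ux|v]; first exact/differentiableZl/d.
apply: Ck_eq (IH _ (h v)) => // x Ux.
by rewrite diffZl//; exact: d.
Qed.

End Calculus.

Lemma Ck_linear_comp (R : realType) (V W W' : normedModType R) k (U : set V)
    (L : {linear W -> W'}) (f : V -> W) :
  open U -> continuous L -> Ck k U f -> Ck k U (L \o f).
Proof.
move=> Uo Lc; elim: k f => [|k IH] f /=.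
  by move=> h x Ux; apply: continuous_comp; [exact: h|exact: Lc].
have dL y : differentiable L y by exact: linear_differentiable.
case=> d h; split=> [x Ux|v]; first exact: differentiable_comp (d x Ux) (dL _).
apply: Ck_eq (IH _ (h v)) => // x Ux.
by rewrite diff_comp//= ?diff_lin//; exact: d.
Qed.

Lemma CkM (R : realType) (V : normedModType R) k (U : set V) (a b : V -> R) :
  open U -> Ck k U a -> Ck k U b -> Ck k U (fun x => a x * b x).
Proof.
move=> Uo; elim: k a b => [|k IH] a b.
  by move=> ha hb x Ux; apply: continuousM; [exact: ha|exact: hb].
move=> ha hb; have ha' := CkW ha; have hb' := CkW hb.
case: ha hb => da ha [db hb]; split=> [x Ux|v].
  by apply: differentiableM; [exact: da|exact: db].
pose F := CkD Uo (IH _ _ ha' (hb v)) (IH _ _ hb' (ha v)).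
apply: (Ck_eq Uo _ F) => x Ux.
by rewrite diffM//; [exact: da|exact: db].
Qed.

Section MatrixCalculus.
Variable R : realType.
Implicit Types (V : normedModType R) (k : nat).

Lemma Ck_coord V m n k (U : set V) (f : V -> 'M[R]_(m, n)) i j :
  open U -> Ck k U f -> Ck k U (fun x => f x i j).
Proof.
move=> Uo h.
have cl : linear (fun M : 'M[R]_(m, n) => M i j : R).
  by move=> a u v; rewrite !mxE.
pose L : {linear 'M[R]_(m, n) -> R} :=
  HB.pack (fun M : 'M[R]_(m, n) => M i j : R)
    (GRing.isLinear.Build _ _ _ _ _ cl).
apply: (@Ck_linear_comp _ _ _ _ _ _ L) => //.
exact: coord_continuous.
Qed.

Lemma Ck_matrix V m n k (U : set V) (f : V -> 'M[R]_(m, n)) :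
  open U -> (forall i j, Ck k U (fun x => f x i j)) -> Ck k U f.
Proof.
move=> Uo h.
have -> : f = fun x => \sum_i \sum_j f x i j *: delta_mx i j.
  by apply/funext => x; exact: matrix_sum_delta.
by apply: Ck_sum => // i; apply: Ck_sum => // j; exact: Ck_scalel.
Qed.

(** The chain rule, [d(g o f)_x v = sum_j (df_x v)_j dg_(f x) e_j], expresses
    the differential by products of a coordinate of a differential of [f] with a
    differential of [g] composed with [f], to which the induction applies.
    Expanding in the basis avoids differentiating the operator-valued map
    [x |-> dg_(f x)]. *)
Lemma Ck_comp_scalar V m k (U : set V) (O : set 'rV[R]_m) (f : V -> 'rV[R]_m)
    (g : 'rV[R]_m -> R) :
  open U -> (forall x, U x -> O (f x)) -> Ck k U f -> Ck k O g ->
  Ck k U (g \o f).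
Proof.
move=> Uo UO; elim: k g f UO => [|k IH] g f UO.
  move=> hf hg x Ux; apply: continuous_comp; first exact: hf.
  exact/hg/UO.
move=> hf hg; have hf' := CkW hf.
case: hf hg => df hf [dg hg]; split=> [x Ux|v].
  by apply: differentiable_comp; [exact: df|exact/dg/UO].
pose F x := \sum_(j < m)
   (('d f x v) ord0 j * ((fun y => 'd g y (delta_mx ord0 j)) \o f) x).
have : Ck k U F.
  apply: Ck_sum => // j; apply: CkM => //.
    by apply: Ck_coord => //; exact: hf.
  by apply: IH => //; exact: hg.
apply: Ck_eq => // x Ux.
rewrite diff_comp; [|exact: df|exact/dg/UO].
rewrite /= [in RHS](row_sum_delta ('d f x v)) linear_sum.
apply: eq_bigr => j _.
exact (esym (linearZZ ('d g (f x)) ('d f x v ord0 j) (delta_mx ord0 j))).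
Qed.

Lemma Ck_comp V m p q k (U : set V) (O : set 'rV[R]_m) (f : V -> 'rV[R]_m)
    (g : 'rV[R]_m -> 'M[R]_(p, q)) :
  open U -> open O -> (forall x, U x -> O (f x)) -> Ck k U f -> Ck k O g ->
  Ck k U (g \o f).
Proof.
move=> Uo Oo UO hf hg; apply: Ck_matrix => // i j.
by apply: (Ck_comp_scalar Uo UO hf (g := fun y => g y i j)); exact: Ck_coord.
Qed.

Lemma Ck_id V k (U : set V) : Ck k U (@id V).
Proof. by apply: (@Ck_linear _ _ _ _ _ idfun) => x; exact: cvg_id. Qed.

Lemma Ck_row_mx V m n k (U : set V) (f : V -> 'rV[R]_m) (g : V -> 'rV[R]_n) :
  open U -> Ck k U f -> Ck k U g -> Ck k U (fun x => row_mx (f x) (g x)).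
Proof.
move=> Uo hf hg; apply: Ck_matrix => // i j.
rewrite -(splitK j); case: (fintype.split j) => l /=.
  have -> : (fun x => row_mx (f x) (g x) i (lshift n l)) = fun x => f x i l.
    by apply/funext => x; rewrite row_mxEl.
  exact: Ck_coord.
have -> : (fun x => row_mx (f x) (g x) i (rshift m l)) = fun x => g x i l.
  by apply/funext => x; rewrite row_mxEr.
exact: Ck_coord.
Qed.

End MatrixCalculus.

(** * Smooth maps and their differentials in charts *)

(** Smoothness is taken relative to a set of charts: this covers the
    product of two manifolds with the atlas of product charts, without making
    the product itself a manifold. *)
Definition is_atlas (R : realType) (n : nat) (M : topologicalType)
    (A : set (chart R n M)) : Prop :=
  (forall c, A c -> is_chart c) /\
  (forall p, exists2 c, A c & chart_dom c p).

Section Charts.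
Variables (R : realType) (n : nat) (M : topologicalType) (c : chart R n M).
Hypothesis hc : is_chart c.

Lemma chart_mapK p : chart_dom c p -> chart_inv c (chart_map c p) = p.
Proof. by case: hc => _ _ _ _; apply. Qed.

Lemma chart_codP x : chart_cod c x <->
  chart_dom c (chart_inv c x) /\ chart_map c (chart_inv c x) = x.
Proof.
split; last by case=> h <-; exists (chart_inv c x).
by case=> p dp <-; rewrite chart_mapK.
Qed.

Lemma chart_imageP (W : set M) x :
  (chart_map c @` (chart_dom c `&` W)) x <->
  chart_cod c x /\ W (chart_inv c x).
Proof.
split=> [[p [dp Wp] <-]|[/chart_codP[dx e] Wx]].
  by split; [exists p|rewrite chart_mapK].
by exists (chart_inv c x).
Qed.

Lemma open_chart_image (W : set M) :
  open W -> open (chart_map c @` (chart_dom c `&` W)).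
Proof.
move=> Wo; rewrite openE => x /chart_imageP[cx Wx].
case: (hc) => _ oc _ ci _; rewrite /interior.
have h1 : nbhs x (chart_cod c) by exact: open_nbhs_nbhs.
have h2 : nbhs x (chart_inv c @^-1` W).
  by apply: (ci x cx); exact: open_nbhs_nbhs.
by apply: filterS (filterI h1 h2) => y [cy Wy]; apply/chart_imageP.
Qed.

End Charts.

Section SmoothMaps.
Variables (R : realType).

(** The domain on which [in_charts c d f] represents [f], as in
    [smooth_on_open] with the whole space as open set. *)
Definition rep_dom (m n : nat) (M N : topologicalType) (c : chart R m M)
    (d : chart R n N) (f : M -> N) : set 'rV[R]_m :=
  chart_map c @` (chart_dom c `&` setT `&` f @^-1` chart_dom d).

Lemma rep_domP m n (M N : topologicalType) (c : chart R m M)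
    (d : chart R n N) (f : M -> N) x : is_chart c ->
  rep_dom c d f x <-> chart_cod c x /\ chart_dom d (f (chart_inv c x)).
Proof. by move=> hc; rewrite /rep_dom setIT; exact: chart_imageP. Qed.

Lemma rep_dom_at m n (M N : topologicalType) (c : chart R m M)
    (d : chart R n N) (f : M -> N) p : is_chart c ->
  chart_dom c p -> chart_dom d (f p) -> rep_dom c d f (chart_map c p).
Proof. by move=> hc cp dp; exists p. Qed.

Lemma open_rep_dom m n (M N : topologicalType) (c : chart R m M)
    (d : chart R n N) (f : M -> N) : is_chart c -> is_chart d ->
  continuous f -> open (rep_dom c d f).
Proof.
move=> hc [od _ _ _ _] fc; rewrite /rep_dom setIT; apply: open_chart_image => //.
by apply: open_comp => // x _; exact: fc.
Qed.

Lemma smooth_continuous m n (M N : topologicalType) (A : set (chart R m M))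
    (B : set (chart R n N)) (f : M -> N) :
  smooth_on_open A B setT f -> continuous f.
Proof. by case=> h _ x; exact: h. Qed.

Lemma in_charts_differentiable m n (M N : topologicalType)
    (A : set (chart R m M)) (B : set (chart R n N)) (f : M -> N) c d p :
  smooth_on_open A B setT f -> A c -> B d -> is_chart c ->
  chart_dom c p -> chart_dom d (f p) ->
  differentiable (in_charts c d f) (chart_map c p).
Proof.
move=> [_ h] Ac Bd hc cp dp.
by have /= [+ _] := h c d Ac Bd 1%N; apply; exact: rep_dom_at.
Qed.

Section Composition.
Variables (m n q : nat) (M N P : topologicalType).
Variables (A : set (chart R m M)) (B : set (chart R n N)).
Variables (C : set (chart R q P)) (f : M -> N) (g : N -> P).
Hypotheses (hA : is_atlas A) (hB : is_atlas B) (hC : is_atlas C).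
Hypotheses (fs : smooth_on_open A B setT f) (gs : smooth_on_open B C setT g).

Let rep_comp (c : chart R m M) (d : chart R n N) (e : chart R q P) :=
  chart_map c @` (chart_dom c `&`
  (f @^-1` chart_dom d `&` (g \o f) @^-1` chart_dom e)).

Let fc : continuous f. Proof. exact: smooth_continuous fs. Qed.
Let gc : continuous g. Proof. exact: smooth_continuous gs. Qed.
Let gfc : continuous (g \o f).
Proof. by move=> x; apply: continuous_comp; [exact: fc|exact: gc]. Qed.

Let rep_comp_open c d e : A c -> B d -> C e -> open (rep_comp c d e).
Proof.
move=> /hA.1 hc /hB.1 [od _ _ _ _] /hC.1 [oe _ _ _ _].
apply: open_chart_image => //; apply: openI.
  by apply: open_comp => // x _; exact: fc.
by apply: open_comp => // x _; exact: gfc.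
Qed.

Let rep_compE c d e x : A c -> B d -> rep_comp c d e x ->
  (in_charts d e g \o in_charts c d f) x = in_charts c e (g \o f) x.
Proof.
move=> /hA.1 hc /hB.1 hd /(chart_imageP hc)[cx [dx ex]].
by rewrite /in_charts /= (chart_mapK hd).
Qed.

Lemma smooth_comp : smooth_on_open A C setT (g \o f).
Proof.
split=> [p _|c e Ac Ce k]; first exact: gfc.
have hc := hA.1 c Ac.
apply: Ck_local => x /(rep_domP _ _ _ hc)[cx ex].
have [d Bd dx] := hB.2 (f (chart_inv c x)).
have hd := hB.1 d Bd.
have oU := rep_comp_open Ac Bd Ce.
exists (rep_comp c d e); first exact/chart_imageP.
apply: Ck_eq (_ : Ck k _ (in_charts d e g \o in_charts c d f)) => //.
  by move=> y; exact: rep_compE.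
apply: (Ck_comp (O := rep_dom d e g)) => //.
- by apply: open_rep_dom => //; exact: hC.1.
- move=> y /(chart_imageP hc)[cy [dy ey]]; apply/rep_domP => //.
  by rewrite /in_charts /=; split; [exists (f (chart_inv c y))|
    rewrite (chart_mapK hd)].
- apply: Ck_sub (fs.2 c d Ac Bd k) => y /(chart_imageP hc)[cy [dy ey]].
  exact/(rep_domP _ _ _ hc).
- exact: gs.2.
Qed.

Lemma tangent_map_comp c d e p v : A c -> B d -> C e ->
  chart_dom c p -> chart_dom d (f p) -> chart_dom e (g (f p)) ->
  tangent_map c e (g \o f) p v =
  tangent_map d e g (f p) (tangent_map c d f p v).
Proof.
move=> Ac Bd Ce cp dp ep.
have hc := hA.1 c Ac; have hd := hB.1 d Bd.
have fE : in_charts c d f (chart_map c p) = chart_map d (f p).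
  by rewrite /in_charts /= (chart_mapK hc).
have df := in_charts_differentiable fs Ac Bd hc cp dp.
have dg := in_charts_differentiable gs Bd Ce hd dp ep.
rewrite -fE in dg.
have := diff_comp df dg.
have  near_comp : \forall y \near chart_map c p,
    (in_charts d e g \o in_charts c d f) y = in_charts c e (g \o f) y.
  have : nbhs (chart_map c p) (rep_comp c d e).
    apply: open_nbhs_nbhs; split; first exact: rep_comp_open.
    by exists p.
  by apply: filterS => y; exact: rep_compE.
have [_ dE] := is_diff_near near_comp (differentiable_comp df dg).
move=> dcomp; rewrite /tangent_map dE dcomp.
by rewrite fE.
Qed.

End Composition.

Lemma tangent_map_id n (M : topologicalType) (c : chart R n M) p v :
  is_chart c -> chart_dom c p -> tangent_map c c id p v = v.
Proof.
move=> hc cp; rewrite /tangent_map.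
have h : \forall y \near chart_map c p, id y = in_charts c c id y.
  have : nbhs (chart_map c p) (chart_cod c).
    by apply: open_nbhs_nbhs; split; [case: hc|exists p].
  by apply: filterS => y /(chart_codP hc)[_ yE]; rewrite /in_charts /= yE.
have did := is_diff_id (chart_map c p).
have [_ ->] := is_diff_near h (@ex_diff _ _ _ _ _ _ _ did).
by rewrite (@diff_val _ _ _ _ _ _ _ did).
Qed.

Section Products.
Variables (m n : nat) (M N : topologicalType).
Variables (A : set (chart R m M)) (B : set (chart R n N)).
Hypotheses (hA : is_atlas A) (hB : is_atlas B).

Lemma continuous_row_mx0 :
  continuous (fun a : 'rV[R]_n => row_mx (0 : 'rV[R]_m) a).
Proof.
move=> a; have h := Ck_row_mx openT (Ck_cst 0 setT (0 : 'rV[R]_m))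
  (@Ck_id R 'rV[R]_n 0 setT).
exact: (h a I).
Qed.

Lemma continuous_row_mx (T : topologicalType) (f : T -> 'rV[R]_m)
    (g : T -> 'rV[R]_n) x :
  {for x, continuous f} -> {for x, continuous g} ->
  {for x, continuous (fun y => row_mx (f y) (g y))}.
Proof.
move=> fx gx.
have -> : (fun y => row_mx (f y) (g y)) =
    (fun y => row_mx (f y) 0 + row_mx 0 (g y)).
  by apply/funext => y; rewrite add_row_mx addr0 add0r.
have cl : continuous (fun a : 'rV[R]_m => row_mx a (0 : 'rV[R]_n)).
  move=> a; have h := Ck_row_mx openT (@Ck_id R 'rV[R]_m 0 setT)
    (Ck_cst 0 setT (0 : 'rV[R]_n)).
  exact: (h a I).
apply: cvgD.
  exact: (cvg_comp f _ fx (cl (f x))).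
exact: (cvg_comp g _ gx (@continuous_row_mx0 (g x))).
Qed.

Lemma prod_chart_is_chart (c : chart R m M) (d : chart R n N) :
  is_chart c -> is_chart d -> is_chart (prod_chart c d).
Proof.
move=> hc hd; have [oc occ cc cic ck] := hc; have [od odc dc dic dk] := hd.
have codE : chart_cod (prod_chart c d) =
    lsubmx @^-1` chart_cod c `&` rsubmx @^-1` chart_cod d.
  apply/seteqP; split=> x /=.
    case=> -[p q] /= [cp dq] <-.
    by rewrite row_mxKl row_mxKr; split; [exists p|exists q].
  case=> -[p cp pE] [q dq qE]; exists (p, q) => //=.
  by rewrite pE qE hsubmxK.
split.
- rewrite (_ : chart_dom _ = fst @^-1` chart_dom c `&` snd @^-1` chart_dom d)//.
  apply: openI; apply: open_comp => // x _; [exact: cvg_fst|exact: cvg_snd].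
- rewrite codE; apply: openI; apply: open_comp => // x _.
    exact: continuous_lsubmx.
  exact: continuous_rsubmx.
- move=> [p q] /= [cp dq]; apply: continuous_row_mx.
    by apply: continuous_comp; [exact: cvg_fst|exact: cc].
  by apply: continuous_comp; [exact: cvg_snd|exact: dc].
- move=> x; rewrite codE => -[/= cx dx]; apply: cvg_pair => /=.
    exact: (nbhs_filter x).
    exact: (cvg_comp lsubmx (chart_inv c) (@continuous_lsubmx R _ _ _ x) (cic _ cx)).
  exact: (cvg_comp rsubmx (chart_inv d) (@continuous_rsubmx R _ _ _ x) (dic _ dx)).
- by move=> [p q] /= [cp dq]; rewrite row_mxKl row_mxKr ck ?dk.
Qed.

Lemma prod_atlas_is_atlas : is_atlas (prod_atlas A B).
Proof.
split=> [_ [c [d [/hA.1 hc /hB.1 hd ->]]]|[p q]].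
  exact: prod_chart_is_chart.
have [c Ac cp] := hA.2 p; have [d Bd dq] := hB.2 q.
by exists (prod_chart c d) => //; exists c, d.
Qed.

Lemma smooth_fst :
  smooth_on_open A A setT id -> smooth_on_open (prod_atlas A B) A setT fst.
Proof.
move=> ids; split=> [p _|_ e [c [d [Ac Bd ->]]] Ae k]; first exact: cvg_fst.
have hc := hA.1 c Ac; have hd := hB.1 d Bd; have he := hA.1 e Ae.
have hcd := prod_chart_is_chart hc hd.
have oU : open (rep_dom (prod_chart c d) e fst).
  by apply: open_rep_dom => // x; exact: cvg_fst.
apply: (@Ck_comp R _ _ _ _ _ _ (rep_dom c e id) lsubmx (in_charts c e id)) => //.
- by apply: open_rep_dom => // x; exact: cvg_id.
- move=> x [[p q] [[[cp dq] _] ep] <-]; apply/rep_domP => //=.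
  by rewrite row_mxKl (chart_mapK hc cp); split => //; exists p.
- exact/Ck_linear/continuous_lsubmx.
- exact: ids.2.
Qed.

Lemma smooth_snd :
  smooth_on_open B B setT id -> smooth_on_open (prod_atlas A B) B setT snd.
Proof.
move=> ids; split=> [p _|_ e [c [d [Ac Bd ->]]] Be k]; first exact: cvg_snd.
have hc := hA.1 c Ac; have hd := hB.1 d Bd; have he := hB.1 e Be.
have hcd := prod_chart_is_chart hc hd.
have oU : open (rep_dom (prod_chart c d) e snd).
  by apply: open_rep_dom => // x; exact: cvg_snd.
apply: (@Ck_comp R _ _ _ _ _ _ (rep_dom d e id) rsubmx (in_charts d e id)) => //.
- by apply: open_rep_dom => // x; exact: cvg_id.
- move=> x [[p q] [[[cp dq] _] eq] <-]; apply/rep_domP => //=.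
  by rewrite row_mxKr (chart_mapK hd dq); split => //; exists q.
- exact/Ck_linear/continuous_rsubmx.
- exact: ids.2.
Qed.

Lemma smooth_cst (b : N) : smooth_on_open A B setT (cst b).
Proof. by split=> [p _|c d Ac Bd k]; [exact: cvg_cst|
  exact: (Ck_cst k _ (chart_map d b))]. Qed.

Lemma smooth_pair q (P : topologicalType) (C : set (chart R q P)) (f : P -> M)
    (g : P -> N) : is_atlas C ->
  smooth_on_open C A setT f -> smooth_on_open C B setT g ->
  smooth_on_open C (prod_atlas A B) setT (fun x => (f x, g x)).
Proof.
move=> hC fs gs; have fc := smooth_continuous fs; have gc := smooth_continuous gs.
have fgc : continuous (fun x => (f x, g x)).
  by move=> x; apply: cvg_pair; [exact: fc|exact: gc].
split=> [p _|e _ Ce [c [d [Ac Bd ->]]] k]; first exact: fgc.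
have he := hC.1 e Ce.
have oU : open (rep_dom e (prod_chart c d) (fun x => (f x, g x))).
  apply: open_rep_dom => //.
  by apply: prod_chart_is_chart; [exact: hA.1|exact: hB.1].
apply: Ck_row_mx => //.
- apply: Ck_sub (fs.2 e c Ce Ac k) => x /(rep_domP _ _ _ he)[ex [cx dx]].
  exact/(rep_domP _ _ _ he).
- apply: Ck_sub (gs.2 e d Ce Bd k) => x /(rep_domP _ _ _ he)[ex [cx dx]].
  exact/(rep_domP _ _ _ he).
Qed.

(** A partial differential of [F] is the differential of [F] in a product chart,
    applied to a vector with first component [0].  The right-hand side shows
    that it depends smoothly on [(a, b)]. *)
Lemma tangent_map_slice q (P : topologicalType) (C : set (chart R q P))
    (F : M * N -> P) c d e a b v : A c -> B d -> C e ->
  smooth_on_open (prod_atlas A B) C setT F ->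
  chart_dom c a -> chart_dom d b -> chart_dom e (F (a, b)) ->
  tangent_map d e (fun y => F (a, y)) b v =
  'd (in_charts (prod_chart c d) e F) (row_mx (chart_map c a) (chart_map d b))
    (row_mx 0 v).
Proof.
move=> Ac Bd Ce Fs ca db eab.
have hc := hA.1 c Ac; have hd := hB.1 d Bd.
set x0 := row_mx _ _.
pose j (z : 'rV[R]_n) : 'rV[R]_(m + n) := row_mx (chart_map c a) z.
have dF : differentiable (in_charts (prod_chart c d) e F) (j (chart_map d b)).
  apply: (@in_charts_differentiable _ _ _ _ _ _ F _ _ (a, b) Fs) => //.
    by exists c, d.
  exact: prod_chart_is_chart.
have lin0 : linear (fun z : 'rV[R]_n => row_mx (0 : 'rV[R]_m) z).
  by move=> t u w; rewrite scale_row_mx add_row_mx scaler0 addr0.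
pose L : {linear 'rV[R]_n -> 'rV[R]_(m + n)} :=
  HB.pack (fun z : 'rV[R]_n => row_mx (0 : 'rV[R]_m) z)
    (GRing.isLinear.Build _ _ _ _ _ lin0).
have Lc : continuous L by exact: continuous_row_mx0.
have jE : j = cst (row_mx (chart_map c a) 0) + (L : _ -> _).
  by apply/funext => z; rewrite !fctE /j /= add_row_mx addr0 add0r.
have dL : differentiable L (chart_map d b) by exact: linear_differentiable.
have dj : differentiable j (chart_map d b).
  by rewrite jE; apply: differentiableD => //; exact: differentiable_cst.
have djE : 'd j (chart_map d b) v = row_mx 0 v.
  have e1 : 'd (cst (row_mx (chart_map c a) (0 : 'rV[R]_n)))
      (chart_map d b) v = 0 by rewrite diff_cst.
  have e2 : 'd L (chart_map d b) v = row_mx 0 v by rewrite diff_lin.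
  rewrite jE (diffD (differentiable_cst _ _) dL).
  by apply: etrans (congr2 +%R e1 e2) _; rewrite add0r.
have FE : in_charts d e (fun y => F (a, y)) =
    in_charts (prod_chart c d) e F \o j.
  apply/funext => z.
  by rewrite /in_charts /= /j row_mxKl row_mxKr (chart_mapK hc).
have dc := diff_comp dj dF.
by rewrite /tangent_map FE dc /= djE.
Qed.

End Products.
End SmoothMaps.

(** * Invariant and quotient inner products *)

Section Frobenius.
Variable R : realType.

Definition sqnorm m n (A : 'M[R]_(m, n)) : R := \sum_i \sum_j A i j ^+ 2.

Lemma sqnorm_ge0 m n (A : 'M[R]_(m, n)) : 0 <= sqnorm A.
Proof. by apply: sumr_ge0 => i _; apply: sumr_ge0 => j _; exact: sqr_ge0. Qed.

Lemma entry_le_sqnorm m n (A : 'M[R]_(m, n)) i j : A i j ^+ 2 <= sqnorm A.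
Proof.
rewrite /sqnorm (bigD1 i)//= (bigD1 j)//= -addrA lerDl addr_ge0//.
  by apply: sumr_ge0 => k _; exact: sqr_ge0.
by apply: sumr_ge0 => k _; apply: sumr_ge0 => l _; exact: sqr_ge0.
Qed.

Lemma sqnorm_eq0 m n (A : 'M[R]_(m, n)) : sqnorm A <= 0 -> A = 0.
Proof.
move=> A0; apply/matrixP => i j; rewrite mxE; apply/eqP.
by rewrite -sqrf_eq0 eq_le sqr_ge0 andbT (le_trans (entry_le_sqnorm A i j)).
Qed.

Lemma sqnorm_tr m n (A : 'M[R]_(m, n)) : sqnorm A^T = sqnorm A.
Proof.
rewrite /sqnorm exchange_big; apply: eq_bigr => i _; apply: eq_bigr => j _.
by rewrite mxE.
Qed.

Lemma sqnormZ m n a (A : 'M[R]_(m, n)) : sqnorm (a *: A) = a ^+ 2 * sqnorm A.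
Proof.
rewrite /sqnorm mulr_sumr; apply: eq_bigr => i _; rewrite mulr_sumr.
by apply: eq_bigr => j _; rewrite mxE exprMn.
Qed.

Lemma sqnorm_parallelogram m n (A B : 'M[R]_(m, n)) :
  sqnorm (A + B) + sqnorm (A - B) = 2 * sqnorm A + 2 * sqnorm B.
Proof.
rewrite /sqnorm !mulr_sumr -!big_split; apply: eq_bigr => i _ /=.
rewrite !mulr_sumr -!big_split; apply: eq_bigr => j _ /=.
by rewrite !mxE; lra.
Qed.

Lemma sqnormD_le m n (A B : 'M[R]_(m, n)) :
  sqnorm (A + B) <= 2 * sqnorm A + 2 * sqnorm B.
Proof. by rewrite -sqnorm_parallelogram lerDl sqnorm_ge0. Qed.

Lemma sqnormN m n (A : 'M[R]_(m, n)) : sqnorm (- A) = sqnorm A.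
Proof. by rewrite -scaleN1r sqnormZ sqrrN expr1n mul1r. Qed.

Lemma sqnorm_rowE n (v : 'rV_n) : sqnorm v = (v *m v^T) 0 0.
Proof.
by rewrite /sqnorm big_ord1 mxE; apply: eq_bigr => j _; rewrite mxE expr2.
Qed.

Lemma sqr_sum_le n (x : 'I_n -> R) :
  (\sum_k x k) ^+ 2 <= n%:R * \sum_k x k ^+ 2.
Proof.
have -> : (\sum_k x k) ^+ 2 = \sum_k \sum_l x k * x l.
  rewrite expr2 mulr_suml; apply: eq_bigr => k _.
  by rewrite mulr_sumr.
have -> : n%:R * \sum_k x k ^+ 2 =
    \sum_k \sum_l (2^-1 * x k ^+ 2 + 2^-1 * x l ^+ 2).
  transitivity (\sum_(k < n) (n%:R * (2^-1 * x k ^+ 2) +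
      2^-1 * \sum_l x l ^+ 2)).
    rewrite big_split /= sumr_const card_ord -!mulr_sumr.
    by rewrite -[(2^-1 * _) *+ n]mulr_natl; lra.
  apply: eq_bigr => k _.
  by rewrite big_split /= sumr_const card_ord mulr_natl mulr_sumr.
apply: ler_sum => k _; apply: ler_sum => l _.
have := sqr_ge0 (x k - x l); lra.
Qed.

(** The constant is far from optimal; it only has to express that a bounded set
    of matrices acts boundedly. *)
Lemma sqnorm_mulmx_le m n p (h : 'M[R]_(m, n)) (S : 'M[R]_(n, p)) C :
  (forall i k, `|h i k| <= C) ->
  sqnorm (h *m S) <= m%:R * (n%:R * C ^+ 2) * sqnorm S.
Proof.
move=> hC; rewrite /sqnorm.
have row i : \sum_j (h *m S) i j ^+ 2 <=
    (n%:R * C ^+ 2) * \sum_k \sum_j S k j ^+ 2.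
  rewrite exchange_big /= mulr_sumr; apply: ler_sum => j _.
  rewrite mxE; apply: le_trans (sqr_sum_le _) _.
  rewrite -mulrA; apply: ler_wpM2l => //.
  rewrite mulr_sumr; apply: ler_sum => k _.
  rewrite exprMn; apply: ler_wpM2r; first exact: sqr_ge0.
  rewrite -(real_normK (num_real (h i k))).
  by apply: lerXn2r => //; rewrite nnegrE// (le_trans _ (hC i k)).
apply: le_trans (ler_sum _ (fun i _ => row i)) _.
by rewrite sumr_const card_ord -[leLHS]mulr_natl -[leRHS]mulrA.
Qed.

End Frobenius.

Section RealSequences.
Variable R : realType.

Lemma ler_addeps_harmonic (x y a : R) :
  (forall k : nat, x <= y + a * k.+1%:R^-1) -> x <= y.
Proof.
move=> h; have [a0|a0] := leP a 0.
  apply: le_trans (h 0%N) _; rewrite gerDl.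
  by rewrite mulr_le0_ge0// invr_ge0.
apply/ler_addgt0Pr => e e0.
have [k kh] := ltr_add_invr (divr_gt0 e0 a0).
rewrite add0r ltr_pdivlMr// in kh.
by apply: le_trans (h k) _; rewrite lerD2l mulrC ltW.
Qed.

(** Convergence of a Cauchy sequence with an explicit modulus, as an order
    property: the limit is the supremum of the lower bounds [u k - d k]. *)
Lemma approximable_limit (u d : nat -> R) :
  (forall k l, u k - u l <= d k + d l) ->
  exists x, forall k, `|u k - x| <= d k.
Proof.
move=> ud; exists (sup (range (fun k => u k - d k))) => k.
have ub l : ubound (range (fun k => u k - d k)) (u l + d l).
  by move=> _ [j _ <-]; have := ud j l; lra.
have h1 : sup (range (fun k => u k - d k)) <= u k + d k.
  by apply: ge_sup => //; exists (u 0%N - d 0%N), 0%N.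
have h2 : u k - d k <= sup (range (fun k => u k - d k)).
  by apply: ub_le_sup; [exists (u 0%N + d 0%N); exact: ub|exists k].
rewrite ler_norml; lra.
Qed.

End RealSequences.

Section Averaging.
Variables (R : realType) (n : nat) (H : set 'M[R]_n).
Hypothesis H1 : H 1%:M.
Hypothesis HM : forall g h, H g -> H h -> H (g *m h).
Hypothesis HV : forall h, H h -> exists2 h', H h' & h *m h' = 1%:M.
Variable C : R.
Hypothesis HC : forall h, H h -> forall i j, `|h i j| <= C.

Let D := n%:R * (n%:R * C ^+ 2) : R.
Let E := D ^+ 2 + 1.

Let D0 : 0 <= D. Proof. by rewrite mulr_ge0// mulr_ge0// sqr_ge0. Qed.
Let E0 : 0 < E. Proof. by rewrite ltr_wpDl// ?sqr_ge0. Qed.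

Definition congruence (h S : 'M[R]_n) := h *m S *m h^T.

Lemma congruence_comp g h S :
  congruence g (congruence h S) = congruence (g *m h) S.
Proof. by rewrite /congruence trmx_mul !mulmxA. Qed.

Lemma congruence1 S : congruence 1%:M S = S.
Proof. by rewrite /congruence trmx1 mulmx1 mul1mx. Qed.

Lemma congruenceD h S S' :
  congruence h (S + S') = congruence h S + congruence h S'.
Proof. by rewrite /congruence mulmxDr mulmxDl. Qed.

Lemma congruenceZ h a S : congruence h (a *: S) = a *: congruence h S.
Proof. by rewrite /congruence -scalemxAr -scalemxAl. Qed.

Lemma congruenceN h S : congruence h (- S) = - congruence h S.
Proof. by rewrite /congruence mulmxN mulNmx. Qed.

(** The congruences by elements of [H] distort the norm by a factor at most [E],
    in both directions, since [H] is a bounded group. *)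
Lemma sqnorm_congruence h S : H h -> sqnorm (congruence h S) <= E * sqnorm S.
Proof.
move=> Hh; have hC := HC Hh.
have h1 : sqnorm (congruence h S) <= D * sqnorm (h *m S).
  rewrite -sqnorm_tr trmx_mul trmxK -[X in _ * X]sqnorm_tr.
  exact: sqnorm_mulmx_le.
apply: le_trans h1 _; rewrite /E mulrDl mul1r.
have h2 : sqnorm (h *m S) <= D * sqnorm S by exact: sqnorm_mulmx_le.
apply: le_trans (ler_wpM2l D0 h2) _.
by rewrite mulrA -expr2 lerDl sqnorm_ge0.
Qed.

Lemma sqnorm_congruence_ge h S : H h -> sqnorm S <= E * sqnorm (congruence h S).
Proof.
move=> Hh; have [h' Hh' /mulmx1C hh'] := HV Hh.
by rewrite -{1}(congruence1 S) -hh' -congruence_comp sqnorm_congruence.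
Qed.

Definition qform (S : 'M[R]_n) (v : 'rV_n) : R := (v *m S *m v^T) 0 0.

Lemma qformE S v : qform S v = \sum_i \sum_j v 0 i * S i j * v 0 j.
Proof.
rewrite /qform mxE exchange_big; apply: eq_bigr => j _.
by rewrite !mxE mulr_suml.
Qed.

Lemma qform_congruence h S v : qform (congruence h S) v = qform S (v *m h).
Proof. by rewrite /qform /congruence trmx_mul !mulmxA. Qed.

(** These are the symmetric [S] with [qform S v >= inf_(h in H) |v h|^2] for all
    [v].  As the lower bound is [H]-invariant and positive for [v != 0], this is
    a convex set of inner products, preserved by [H], in which limits of
    minimizing sequences remain positive definite. *)
Definition dominating : set 'M[R]_n := [set S | S^T = S /\
  forall v c, (forall h, H h -> c <= sqnorm (v *m h)) -> c <= qform S v].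

Lemma dominating1 : dominating 1%:M.
Proof.
split=> [|v c]; first exact: trmx1.
by move=> /(_ _ H1); rewrite sqnorm_rowE /qform !mulmx1.
Qed.

Lemma dominating_mid S S' : dominating S -> dominating S' ->
  dominating (2^-1 *: (S + S')).
Proof.
move=> [sS dS] [sS' dS']; split=> [|v c cv].
  by rewrite linearZ/= linearD/= sS sS'.
have := dS v c cv; have := dS' v c cv.
have -> : qform (2^-1 *: (S + S')) v = 2^-1 * (qform S v + qform S' v).
  by rewrite /qform -scalemxAr -scalemxAl mulmxDr mulmxDl !mxE.
lra.
Qed.

Lemma dominating_congruence h S : H h -> dominating S ->
  dominating (congruence h S).
Proof.
move=> Hh [sS dS]; split=> [|v c cv].
  by rewrite /congruence !trmx_mul trmxK sS mulmxA.
rewrite qform_congruence; apply: dS => g Hg; rewrite -mulmxA.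
exact/cv/HM.
Qed.

Lemma dominating_posdef S v : dominating S -> v != 0 -> 0 < qform S v.
Proof.
move=> [sS dS] v0.
have fv : 0 < sqnorm v.
  by rewrite lt_neqAle sqnorm_ge0 andbT; apply: contraNN v0 => /eqP fv;
    apply/eqP/sqnorm_eq0; rewrite -fv.
apply: lt_le_trans (_ : sqnorm v / (D + 1) <= _).
  by rewrite divr_gt0// ltr_wpDl.
apply: dS => h Hh; rewrite ler_pdivrMr ?ltr_wpDl//.
have [h' Hh' hh'] := HV Hh.
have -> : sqnorm v = sqnorm (h'^T *m (v *m h)^T).
  by rewrite -trmx_mul sqnorm_tr -mulmxA hh' mulmx1.
apply: le_trans (@sqnorm_mulmx_le _ _ _ _ _ _ C _) _.
  by move=> i k; rewrite mxE; exact: HC.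
by rewrite sqnorm_tr mulrC -/D ler_wpM2l ?sqnorm_ge0// lerDl.
Qed.

(** The objective to be minimized: it is [H]-invariant, and as a supremum of
    Euclidean norms uniformly equivalent to each other it inherits their uniform
    convexity. *)
Definition orbit_sqnorm S : R := sup [set sqnorm (congruence h S) | h in H].

Lemma sqnorm_le_orbit h S : H h -> sqnorm (congruence h S) <= orbit_sqnorm S.
Proof.
move=> Hh; apply: ub_le_sup; last by exists h.
by exists (E * sqnorm S) => _ [g Hg <-]; exact: sqnorm_congruence.
Qed.

Lemma orbit_sqnorm_le S x :
  (forall h, H h -> sqnorm (congruence h S) <= x) -> orbit_sqnorm S <= x.
Proof.
move=> Sx; apply: ge_sup; first by exists (sqnorm (congruence 1%:M S)), 1%:M.
by move=> _ [h Hh <-]; exact: Sx.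
Qed.

Lemma orbit_sqnorm_congruence g S : H g ->
  orbit_sqnorm (congruence g S) <= orbit_sqnorm S.
Proof.
move=> Hg; apply: orbit_sqnorm_le => h Hh.
by rewrite congruence_comp; apply: sqnorm_le_orbit; exact: HM.
Qed.

Let m := inf [set orbit_sqnorm S | S in dominating].

Let m_le S : dominating S -> m <= orbit_sqnorm S.
Proof.
move=> dS; apply: ge_inf; last by exists S.
exists 0 => _ [T _ <-].
by apply: le_trans (sqnorm_le_orbit T H1); exact: sqnorm_ge0.
Qed.

(** Uniform convexity: by the parallelogram identity, the objective at the
    midpoint of [S] and [S'] is below the mean of its values by a multiple of
    the square of their distance, while it cannot be below the infimum. *)
Lemma near_minimizers_close S S' e e' : dominating S -> dominating S' ->
  orbit_sqnorm S <= m + e -> orbit_sqnorm S' <= m + e' ->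
  sqnorm (S - S') <= 2 * E * (e + e').
Proof.
move=> dS dS' Se Se'.
suff : orbit_sqnorm (2^-1 *: (S + S')) <=
    m + 2^-1 * (e + e') - E^-1 * (4^-1 * sqnorm (S - S')).
  have := m_le (dominating_mid dS dS') => m1 m2.
  have {m1 m2} := le_trans m1 m2.
  rewrite -addrA lerDl subr_ge0 ler_pdivrMl//; lra.
apply: orbit_sqnorm_le => h Hh.
rewrite congruenceZ congruenceD sqnormZ.
have := sqnorm_parallelogram (congruence h S) (congruence h S').
have := sqnorm_le_orbit S Hh.
have := sqnorm_le_orbit S' Hh.
have := sqnorm_congruence_ge (S - S') Hh; rewrite congruenceD congruenceN.
rewrite -ler_pdivrMl// => h1 h2 h3 h4.
have -> : E^-1 * (4^-1 * sqnorm (S - S')) = 4^-1 * (E^-1 * sqnorm (S - S')).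
  by ring.
lra.
Qed.

(** The slack [delta k ^+ 2] in the objective turns into a distance of order
    [delta k] by [near_minimizers_close]; the factor [b], with
    [b ^+ 2 >= 2 * E], is the constant of that estimate. *)
Let delta (k : nat) : R := k.+1%:R^-1.
Let delta0 k : 0 < delta k. Proof. by rewrite invr_gt0. Qed.
Let delta1 k : delta k <= 1. Proof. by rewrite invf_le1// ler1n. Qed.
Let b := 2 * E + 1.
Let b0 : 0 < b. Proof. rewrite /b; have := E0; lra. Qed.

Lemma minimizing_sequence : exists S : nat -> 'M[R]_n, forall k,
  dominating (S k) /\ orbit_sqnorm (S k) <= m + delta k ^+ 2.
Proof.
have /choice[S HS] k :
    exists T, dominating T /\ orbit_sqnorm T <= m + delta k ^+ 2.
  have inf_m : has_inf [set orbit_sqnorm S | S in dominating].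
    split; first by exists (orbit_sqnorm 1%:M), 1%:M => //; exact: dominating1.
    exists 0 => _ [T _ <-].
    by apply: le_trans (sqnorm_le_orbit T H1); exact: sqnorm_ge0.
  have dk : 0 < delta k ^+ 2 by rewrite exprn_gt0.
  have [_ [T dT <-] Tm] := inf_adherent dk inf_m.
  by exists T; split=> //; exact: ltW.
by exists S.
Qed.

(** Every bounded group of matrices preserves an inner product.  Translating an
    almost minimizer [S k] gives an almost minimizer, which is close to [S k];
    hence the limit [B] of the [S k] is fixed. *)
Theorem exists_invariant_form : exists B : 'M[R]_n,
  [/\ B^T = B, forall v, v != 0 -> 0 < qform B v &
      forall h, H h -> congruence h B = B].
Proof.
have [S HS] := minimizing_sequence.
have close k l : sqnorm (S k - S l) <= (b * (delta k + delta l)) ^+ 2.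
  have [dk sk] := HS k; have [dl sl] := HS l.
  apply: le_trans (near_minimizers_close dk dl sk sl) _.
  have := delta0 k; have := delta0 l; have := E0; rewrite /b.
  move: (delta k) (delta l) => x y EE y0 x0.
  have xy : x ^+ 2 + y ^+ 2 <= (x + y) ^+ 2 by nra.
  rewrite exprMn; apply: ler_pM => //; [nra|nra|nra].
have [B HB] : exists B : 'M[R]_n,
    forall k i j, `|S k i j - B i j| <= b * delta k.
  have /choice[B HB] : forall ij : 'I_n * 'I_n, exists x,
      forall k, `|S k ij.1 ij.2 - x| <= b * delta k.
    move=> [i j]; apply: approximable_limit => k l /=.
    rewrite -mulrDr; apply: le_trans (ler_norm _) _.
    have bd : 0 <= b * (delta k + delta l).
      by apply: mulr_ge0; [exact: ltW|apply: addr_ge0; exact: ltW].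
    rewrite -ler_sqr ?nnegrE//.
    rewrite real_normK ?num_real//.
    apply: le_trans _ (close k l).
    by have := entry_le_sqnorm (S k - S l) i j; rewrite !mxE.
  by exists (\matrix_(i, j) B (i, j)) => k i j; rewrite mxE; exact: (HB (i, j)).
exists B.
(* The entrywise bound gives [n ^ 2 * (b * delta k) ^ 2], where [delta k <= 1]. *)
have Bdelta k : sqnorm (S k - B) <= n%:R * n%:R * b ^+ 2 * delta k.
  have -> : n%:R * n%:R * b ^+ 2 * delta k =
      \sum_(i < n) \sum_(j < n) b ^+ 2 * delta k.
    rewrite !sumr_const card_ord -[RHS]mulr_natl -[(_ * _) *+ n]mulr_natl.
    by rewrite !mulrA.
  apply: ler_sum => i _; apply: ler_sum => j _.
  rewrite !mxE -real_normK ?num_real//.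
  apply: le_trans (_ : (b * delta k) ^+ 2 <= _).
    have bd : 0 <= b * delta k by apply: mulr_ge0; exact: ltW.
    by rewrite ler_sqr ?nnegrE.
  rewrite exprMn ler_wpM2l ?sqr_ge0// expr2.
  by rewrite -[leRHS]mul1r; apply: ler_wpM2r; [exact: ltW|exact: delta1].
have symB : B^T = B.
  apply/matrixP => i j; rewrite mxE; apply/eqP.
  rewrite -subr_eq0 -normr_eq0 eq_le normr_ge0 andbT.
  apply: (@ler_addeps_harmonic _ _ _ (2 * b)) => k; rewrite add0r.
  have [[+ _] _] := HS k => /matrixP/(_ i j); rewrite mxE => e.
  have := HB k i j; have := HB k j i; rewrite e !ler_norml -/(delta k).
  by move=> /andP[? ?] /andP[? ?]; apply/andP; split; lra.
have domB : dominating B.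
  split=> // v c cv.
  apply: (@ler_addeps_harmonic _ _ _
    (\sum_i \sum_j `|v 0 i| * b * `|v 0 j|)) => k.
  rewrite -/(delta k); have [[_ dk] _] := HS k.
  apply: le_trans (dk v c cv) _.
  rewrite -lerBlDl !qformE -sumrB mulr_suml; apply: ler_sum => i _.
  rewrite -sumrB mulr_suml; apply: ler_sum => j _.
  rewrite -mulrBl -mulrBr.
  apply: le_trans (ler_norm _) _; rewrite !normrM.
  have -> : `|v 0 i| * b * `|v 0 j| * delta k =
    `|v 0 i| * (b * delta k) * `|v 0 j| by ring.
  by rewrite ler_wpM2r// ler_wpM2l.
split=> //; first by move=> v; exact: dominating_posdef.
move=> h Hh; apply/eqP; rewrite -subr_eq0; apply/eqP/sqnorm_eq0.
pose K := n%:R * n%:R * b ^+ 2.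
have K0 : 0 <= K by rewrite /K mulr_ge0// ?sqr_ge0// mulr_ge0.
(* In the decomposition below, [B - S k] and [S k - B] contribute
   [2 * E * K * delta k] and [4 * K * delta k], and the displacement of [S k]
   contributes [4 * (2 * E * (2 * delta k ^+ 2))]. *)
apply: (@ler_addeps_harmonic _ _ _ (2 * E * K + 16 * E + 4 * K)) => k.
rewrite add0r -/(delta k).
have -> : congruence h B - B =
    congruence h (B - S k) + ((congruence h (S k) - S k) + (S k - B)).
  by rewrite congruenceD congruenceN !addrA subrK subrK.
apply: le_trans (sqnormD_le _ _) _.
have e1 := sqnorm_congruence (B - S k) Hh.
rewrite -(opprB (S k) B) congruenceN !sqnormN in e1.
have e2 := Bdelta k; rewrite -/K in e2.
have e3 := sqnormD_le (congruence h (S k) - S k) (S k - B).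
have [dk sk] := HS k.
have sk' := le_trans (orbit_sqnorm_congruence (S k) Hh) sk.
have e4 := near_minimizers_close (dominating_congruence Hh dk) dk sk' sk.
have e5 : delta k ^+ 2 <= delta k.
  by rewrite expr2 -[leRHS]mul1r; apply: ler_wpM2r; [exact: ltW|].
have e6 : E * sqnorm (S k - B) <= E * (K * delta k).
  by apply: ler_wpM2l => //; exact: ltW.
have e7 : E * delta k ^+ 2 <= E * delta k.
  by apply: ler_wpM2l => //; exact: ltW.
rewrite -(opprB (S k) B) congruenceN sqnormN.
nra.
Qed.

End Averaging.

Section QuotientForm.
Variables (R : realType) (m n : nat) (B : 'M[R]_m) (A : 'M[R]_(m, n)).
Hypothesis symB : B^T = B.
Hypothesis posB : forall v, v != 0 -> 0 < qform B v.
Hypothesis surjA : forall w : 'rV_n, exists v, v *m A = w.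

Lemma posdef_eq0 v : qform B v = 0 -> v = 0.
Proof.
by move=> v0; apply/eqP; apply/negPn/negP => /posB; rewrite v0 ltxx.
Qed.

Lemma posdef_unit : B \in unitmx.
Proof.
rewrite -row_free_unit -kermx_eq0; apply/eqP/row_matrixP => i.
rewrite row0; apply: posdef_eq0.
by rewrite /qform -row_mul mulmx_ker row0 mul0mx mxE.
Qed.

(** With [B] an inner product on row vectors and [A] a surjection, the dual
    inner product restricted along [A] has matrix [G = A^T B^-1 A], and the quotient
    inner product is [B0 = G^-1].  It is more convenient to use the orthogonal
    section [L = G^-1 A^T B^-1] of [A], whose image is the orthogonal complement
    of the kernel of [A], and to set [B0 = L B L^T]. *)
Theorem exists_quotient_form : exists B0 : 'M[R]_n,
  [/\ B0^T = B0, forall w, w != 0 -> 0 < qform B0 w &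
      forall v w : 'rV_m,
        (forall k : 'rV_m, k *m A = 0 -> (v *m B *m k^T) 0 0 = 0) ->
        (v *m B *m w^T) 0 0 = (v *m A *m B0 *m (w *m A)^T) 0 0].
Proof.
have Bu := posdef_unit.
have symV : (invmx B)^T = invmx B by rewrite trmx_inv symB.
pose G := A^T *m invmx B *m A.
have Gu : G \in unitmx.
  rewrite -row_free_unit -kermx_eq0; apply/eqP/row_matrixP => i.
  rewrite row0; set y := row i _.
  have yG : y *m G = 0 by rewrite /y -row_mul mulmx_ker row0.
  have yA : y *m A^T *m invmx B = 0.
    apply: posdef_eq0; rewrite /qform mulmxKV// trmx_mul symV.
    have -> : y *m A^T *m (invmx B *m (y *m A^T)^T) = y *m G *m y^T.
      by rewrite trmx_mul trmxK /G !mulmxA.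
    by rewrite yG mul0mx mxE.
  have yA0 : y *m A^T = 0 by rewrite -(mulmxKV Bu (y *m A^T)) yA mul0mx.
  have [v vA] := surjA y.
  suff : sqnorm y <= 0 by exact: sqnorm_eq0.
  by rewrite sqnorm_rowE -{2}vA trmx_mul mulmxA yA0 mul0mx mxE.
pose L := invmx G *m A^T *m invmx B.
have LA : L *m A = 1%:M.
  by rewrite /L -!mulmxA [_ *m (_ *m A)]mulmxA mulVmx.
have LB w k : k *m A = 0 -> (w *m L *m B *m k^T) 0 0 = 0.
  move=> kA; rewrite /L !mulmxA mulmxKV// -mulmxA -trmx_mul kA trmx0 mulmx0.
  by rewrite mxE.
clearbody L; exists (L *m B *m L^T); split.
- by rewrite !trmx_mul trmxK symB mulmxA.
- move=> w w0; rewrite /qform.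
  have -> : w *m (L *m B *m L^T) *m w^T = (w *m L) *m B *m (w *m L)^T.
    by rewrite trmx_mul !mulmxA.
  apply: posB; apply: contraNN w0 => /eqP wL.
  by rewrite -(mulmx1 w) -LA mulmxA wL mul0mx.
- move=> v w vh.
  have vE : v = v *m A *m L.
    apply/eqP; rewrite -subr_eq0; apply/eqP/posdef_eq0.
    have kA : (v - v *m A *m L) *m A = 0.
      by rewrite mulmxBl -[v *m A *m L *m A]mulmxA LA mulmx1 subrr.
    rewrite /qform [_ *m B]mulmxBl mulmxBl mxE (vh _ kA) add0r mxE LB//.
    by rewrite oppr0.
  have wE : (v *m B *m w^T) 0 0 = (v *m B *m (w *m A *m L)^T) 0 0.
    have kA : (w - w *m A *m L) *m A = 0.
      by rewrite mulmxBl -[w *m A *m L *m A]mulmxA LA mulmx1 subrr.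
    have := vh _ kA; rewrite linearB/= mulmxBr !mxE => /eqP.
    by rewrite subr_eq0 => /eqP.
  by rewrite wE {1}vE !trmx_mul !mulmxA.
Qed.

End QuotientForm.

(** * Lie groups and left-invariant forms *)

Section TangentMatrices.
Variable R : realType.

Lemma manifold_is_atlas n (M : manifoldType R n) : is_atlas (atlas M).
Proof. by split; [exact: atlas_is_chart|exact: atlas_cover]. Qed.

Lemma exists_chart_at n (M : manifoldType R n) (p : M) :
  exists c, chart_at p c.
Proof. by have [c Ac cp] := atlas_cover p; exists c. Qed.

Lemma smooth_id n (M : manifoldType R n) : smooth (@id M).
Proof. exact: atlas_compatible. Qed.

(** The matrix of [tangent_map] acting on row vectors on the right, so that the
    chain rule reads from left to right. *)
Definition tangent_mx m n (M N : Type) (c : chart R m M) (d : chart R n N)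
    (f : M -> N) (p : M) : 'M[R]_(m, n) :=
  lin1_mx ('d (in_charts c d f) (chart_map c p)).

Lemma mul_tangent_mx m n (M N : Type) (c : chart R m M) (d : chart R n N)
    (f : M -> N) (p : M) v :
  v *m tangent_mx c d f p = tangent_map c d f p v.
Proof. by rewrite /tangent_mx mul_rV_lin1. Qed.

Lemma eq_from_row m n (A B : 'M[R]_(m, n)) :
  (forall v : 'rV_m, v *m A = v *m B) -> A = B.
Proof. by move=> h; apply/row_matrixP => i; rewrite !rowE h. Qed.

Lemma tangent_mx_comp m n q (M : manifoldType R m) (N : manifoldType R n)
    (P : manifoldType R q) (f : M -> N) (g : N -> P) c d e p :
  smooth f -> smooth g ->
  chart_at p c -> chart_at (f p) d -> chart_at (g (f p)) e ->
  tangent_mx c e (g \o f) p = tangent_mx c d f p *m tangent_mx d e g (f p).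
Proof.
move=> fs gs [Ac cp] [Ad dp] [Ae ep]; apply: eq_from_row => v.
rewrite mulmxA !mul_tangent_mx.
by apply: (tangent_map_comp _ _ _ fs gs) => //; exact: manifold_is_atlas.
Qed.

Lemma tangent_mx_id n (M : manifoldType R n) c (p : M) : chart_at p c ->
  tangent_mx c c id p = 1%:M.
Proof.
move=> [Ac cp]; apply: eq_from_row => v; rewrite mul_tangent_mx mulmx1.
by apply: tangent_map_id => //; exact: atlas_is_chart.
Qed.

End TangentMatrices.

Section LieGroups.
Variables (R : realType) (n : nat) (G : lieGroupType R n).
Implicit Types (g h p : G).

Let hG := manifold_is_atlas G.
Let hGG := prod_atlas_is_atlas hG hG.

Lemma smooth_pairM q (P : topologicalType) (C : set (chart R q P))
    (f g : P -> G) : is_atlas C -> smooth_on_open C (atlas G) setT f ->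
  smooth_on_open C (atlas G) setT g ->
  smooth_on_open C (atlas G) setT (fun x => f x * g x)%g.
Proof.
move=> hC fs gs.
exact: (smooth_comp hC hGG hG (smooth_pair hG hG hC fs gs) mulg_smooth).
Qed.

Lemma smooth_inv q (P : topologicalType) (C : set (chart R q P))
    (f : P -> G) : is_atlas C -> smooth_on_open C (atlas G) setT f ->
  smooth_on_open C (atlas G) setT (fun x => (f x)^-1)%g.
Proof. by move=> hC fs; exact: (smooth_comp hC hG hG fs invg_smooth). Qed.

Let fst_smooth :
  smooth_on_open (prod_atlas (atlas G) (atlas G)) (atlas G) setT fst.
Proof. by apply: smooth_fst => //; exact: smooth_id. Qed.

Let snd_smooth :
  smooth_on_open (prod_atlas (atlas G) (atlas G)) (atlas G) setT snd.
Proof. by apply: smooth_snd => //; exact: smooth_id. Qed.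

Definition left_div (q : G * G) : G := (q.1^-1 * q.2)%g.

Lemma smooth_left_div :
  smooth_on_open (prod_atlas (atlas G) (atlas G)) (atlas G) setT left_div.
Proof. by apply: smooth_pairM => //; exact: smooth_inv. Qed.

Lemma smooth_left_mul g : smooth (fun h => g * h)%g.
Proof.
by apply: smooth_pairM => //; [exact: smooth_cst|exact: smooth_id].
Qed.

Lemma smooth_right_mul g : smooth (fun h => h * g)%g.
Proof.
by apply: smooth_pairM => //; [exact: smooth_id|exact: smooth_cst].
Qed.

Definition conj_twist (phi : G -> G) (q : G * G) : G :=
  (q.1 * phi q.2 * q.1^-1)%g.

Lemma smooth_conj_twist phi : smooth phi ->
  smooth_on_open (prod_atlas (atlas G) (atlas G)) (atlas G) setT
    (conj_twist phi).
Proof.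
move=> phis; apply: smooth_pairM => //; last exact: smooth_inv.
by apply: smooth_pairM => //; exact: (smooth_comp hGG hG hG snd_smooth phis).
Qed.

Lemma smooth_conj_twist_slice phi g : smooth phi ->
  smooth (fun h => conj_twist phi (g, h)).
Proof.
move=> phis; rewrite /conj_twist /=.
apply: smooth_pairM => //; last exact: smooth_cst.
by apply: smooth_pairM => //; exact: smooth_cst.
Qed.

Lemma diffeomorphism_left_mul g : diffeomorphism (fun h => g * h)%g.
Proof.
split; first exact: smooth_left_mul.
by exists (fun h => g^-1 * h)%g; split; [exact: smooth_left_mul| |] => h;
  rewrite mulgA ?mulVg ?mulgV mul1g.
Qed.

Lemma diffeomorphism_right_mul g : diffeomorphism (fun h => h * g)%g.
Proof.
split; first exact: smooth_right_mul.
by exists (fun h => h * g^-1)%g; split; [exact: smooth_right_mul| |] => h;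
  rewrite -mulgA ?mulVg ?mulgV mulg1.
Qed.

Lemma tangent_mx_slice (F : G * G -> G) c d e (a b : G) i j :
  smooth_on_open (prod_atlas (atlas G) (atlas G)) (atlas G) setT F ->
  chart_at a c -> chart_at b d -> chart_at (F (a, b)) e ->
  tangent_mx d e (fun y => F (a, y)) b i j =
  'd (in_charts (prod_chart c d) e F) (row_mx (chart_map c a) (chart_map d b))
    (row_mx 0 (delta_mx 0 i)) 0 j.
Proof.
move=> Fs [Ac ca] [Ad db] [Ae eab].
rewrite -(tangent_map_slice hG hG _ Ac Ad Ae Fs) //.
by rewrite -mul_tangent_mx -rowE [RHS]mxE.
Qed.

Section Compactness.
Hypothesis cptG : compact (@setT G).
Variables (c0 : chart R n G) (F : G * G -> G).
Hypothesis c01 : chart_at (1%g : G) c0.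
Hypothesis Fs :
  smooth_on_open (prod_atlas (atlas G) (atlas G)) (atlas G) setT F.
Hypothesis F1 : forall g, F (g, 1%g) = 1%g.

Let u i j g := tangent_mx c0 c0 (fun h => F (g, h)) 1%g i j.

Lemma continuous_tangent_family i j : continuous (u i j).
Proof.
move=> g0; have [c [Ac cg0]] := exists_chart_at g0.
have hc := hG.1 c Ac; have [A0 c00] := c01; have h0 := hG.1 c0 A0.
set w := row_mx (0 : 'rV[R]_n) (delta_mx 0 i).
pose Phi := in_charts (prod_chart c c0) c0 F.
pose r g := row_mx (chart_map c g) (chart_map c0 (1%g : G)).
have rc : {for g0, continuous r}.
  apply: continuous_row_mx; last exact: cvg_cst.
  by case: hc => _ _ + _ _; apply.
have dc : {for r g0, continuous (fun x => 'd Phi x w)}.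
  have Or : rep_dom (prod_chart c c0) c0 F (r g0).
    by exists (g0, 1%g) => //=; rewrite F1.
  have Ac0 : prod_atlas (atlas G) (atlas G) (prod_chart c c0).
    by exists c, c0.
  have /= [_ /(_ w) dPhi] := Fs.2 _ _ Ac0 A0 1%N.
  exact: dPhi _ Or.
have vc : {for g0, continuous (fun g => ('d Phi (r g) w) 0 j)}.
  apply: (cvg_comp (fun g => 'd Phi (r g) w) (fun M : 'rV[R]_n => M 0 j)).
    exact: (cvg_comp r (fun x => 'd Phi x w) rc dc).
  exact: coord_continuous.
have e : \forall g \near g0, ('d Phi (r g) w) 0 j = u i j g.
  have : nbhs g0 (chart_dom c) by apply: open_nbhs_nbhs; case: hc.
  by apply: filterS => g cg; rewrite /u (tangent_mx_slice _ _ Fs (c := c)) ?F1.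
apply: cvg_trans (_ : (fun g => ('d Phi (r g) w) 0 j) @ g0 --> u i j g0).
  exact: near_eq_cvg.
by rewrite -(nbhs_singleton e); exact: vc.
Qed.

(** The entries of these matrices are partial differentials of [F], hence depend
    continuously on the parameter [g], which ranges over a compact space. *)
Lemma bounded_tangent_family :
  exists C, forall g i j, `|tangent_mx c0 c0 (fun h => F (g, h)) 1%g i j| <= C.
Proof.
have /choice[C HC] : forall ij : 'I_n * 'I_n, exists C, forall g,
    `|u ij.1 ij.2 g| <= C.
  move=> [i j] /=.
  have [|//||g _ gmax] := @compact_EVT_max G R (fun g => `|u i j g|) setT.
  - by exists 1%g.
  - apply: continuous_subspaceT => g.
    exact: (cvg_norm (@continuous_tangent_family i j g)).
  - by exists (`|u i j g|) => h; apply: gmax; rewrite inE.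
exists (\big[Num.max/0]_ij C ij) => g i j.
apply: le_trans (HC (i, j) g) _; exact: le_bigmax.
Qed.

End Compactness.

Section LeftMetric.
Variable c0 : chart R n G.
Hypothesis c01 : chart_at (1%g : G) c0.

(** The left Maurer-Cartan form at [p]: it brings tangent vectors at [p] back to
    [1] by a left translation, and reads the result in the chart [c0]. *)
Definition maurer_cartan (c : chart R n G) (p : G) : 'M[R]_n :=
  tangent_mx c c0 (fun h => p^-1 * h)%g p.

Lemma maurer_cartan_unit c p : chart_at p c -> maurer_cartan c p \in unitmx.
Proof.
move=> cp.
suff : maurer_cartan c p *m tangent_mx c0 c (fun h => p * h)%g 1%g = 1%:M.
  by move=> h; exact: (mulmx1_unit h).1.
have pV : (p^-1 * p)%g = 1%g :> G by rewrite mulVg.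
rewrite -(tangent_mx_id cp) /maurer_cartan -pV -tangent_mx_comp.
- congr (tangent_mx _ _ _ _); apply/funext => h /=.
  by rewrite mulgA mulgV mul1g.
- exact: smooth_left_mul.
- exact: smooth_left_mul.
- exact: cp.
- by rewrite pV.
- by rewrite pV mulg1.
Qed.

Definition left_gram (B : 'M[R]_n) : gram_field R n G :=
  fun c p => maurer_cartan c p *m B *m (maurer_cartan c p)^T.

Lemma inner_left_gram B c p v w :
  inner (left_gram B) c p v w =
  (v *m maurer_cartan c p *m B *m (w *m maurer_cartan c p)^T) 0 0.
Proof. by rewrite /inner /left_gram trmx_mul !mulmxA. Qed.

(** The Maurer-Cartan form at [p] is the partial differential of
    [(a, b) |-> a^-1 b] at [(p, p)], so its smoothness in [p] follows from the
    smoothness of the group law on [G * G], restricted to the diagonal. *)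
Lemma left_gram_smooth B c : atlas G c ->
  Cinfty (chart_cod c) (fun x => left_gram B c (chart_inv c x)).
Proof.
move=> Ac k; have hc := hG.1 c Ac; have [A0 c00] := c01.
have h0 := hG.1 c0 A0.
have oc : open (chart_cod c) by case: hc.
pose Phi := in_charts (prod_chart c c) c0 left_div.
have entry i j : Ck k (chart_cod c) (fun x => maurer_cartan c (chart_inv c x) i j).
  have h : Ck k (rep_dom (prod_chart c c) c0 left_div)
      (fun x => 'd Phi x (row_mx 0 (delta_mx 0 i))).
    by have /= [_] := smooth_left_div.2 (prod_chart c c) c0
      (ex_intro _ c (ex_intro _ c (And3 Ac Ac erefl))) A0 k.+1; apply.
  have hd : Ck k (chart_cod c) (fun x => row_mx x x).
    by apply: Ck_row_mx => //; exact: Ck_id.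
  have hcc := prod_chart_is_chart hc hc.
  have oO : open (rep_dom (prod_chart c c) c0 left_div).
    by apply: open_rep_dom => //; exact: smooth_continuous smooth_left_div.
  have dO x : chart_cod c x ->
      rep_dom (prod_chart c c) c0 left_div (row_mx x x).
    case=> p cp <-.
    apply: (@rep_dom_at _ _ _ _ _ (prod_chart c c) c0 left_div (p, p)) => //.
    by rewrite /left_div /= mulVg.
  apply: Ck_eq (Ck_coord 0 j oc (Ck_comp oc oO dO hd h)) => // x cx.
  have [ix xE] := (chart_codP hc x).1 cx.
  set p := chart_inv c x in ix xE *.
  have cp : chart_at p c by [].
  have dp : chart_at (left_div (p, p)) c0 by rewrite /left_div /= mulVg.
  have e := tangent_mx_slice i j smooth_left_div cp cp dp.
  rewrite xE in e; exact: esym e.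
apply: Ck_matrix => // i j.
have e x : left_gram B c (chart_inv c x) i j =
    \sum_l (\sum_m maurer_cartan c (chart_inv c x) i m * B m l) *
      maurer_cartan c (chart_inv c x) j l.
  by rewrite /left_gram mxE; apply: eq_bigr => l _; rewrite !mxE.
rewrite (funext e); apply: Ck_sum => // l; apply: CkM => //.
by apply: Ck_sum => // m; apply: CkM => //; exact: Ck_cst.
Qed.

End LeftMetric.
End LieGroups.

Section Equivariance.
Variables (R : realType) (m n : nat).
Variables (G : lieGroupType R m) (G' : lieGroupType R n).
Variables (c0 : chart R m G) (c0' : chart R n G').
Hypotheses (c01 : chart_at (1%g : G) c0) (c01' : chart_at (1%g : G') c0').

(** Differentiating [(f p)^-1 * f h = phi (p^-1 * h)] at [h = p].  The map [phi]
    is the identity for left translations and changes of chart, a conjugation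
    for right translations, and [f] itself for homomorphisms. *)
Lemma tangent_maurer_cartan (f phi : G -> G') p c d : smooth f -> smooth phi ->
  phi 1%g = 1%g -> (forall h, (f p)^-1 * f h = phi (p^-1 * h))%g ->
  chart_at p c -> chart_at (f p) d ->
  tangent_mx c d f p *m maurer_cartan c0' d (f p) =
  maurer_cartan c0 c p *m tangent_mx c0 c0' phi 1%g.
Proof.
move=> fs phis phi1 fphi cp dp.
have pV : (p^-1 * p)%g = 1%g :> G by rewrite mulVg.
have d1 : chart_at ((f p)^-1 * f p)%g c0' by rewrite mulVg.
have d2 : chart_at (p^-1 * p)%g c0 by rewrite pV.
have d3 : chart_at (phi (p^-1 * p)%g) c0' by rewrite pV phi1.
have e1 := tangent_mx_comp fs (smooth_left_mul (f p)^-1%g) cp dp d1.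
have e2 := tangent_mx_comp (smooth_left_mul p^-1%g) phis cp d2 d3.
have e12 : (fun h => (f p)^-1 * h)%g \o f = phi \o (fun h => p^-1 * h)%g.
  by apply/funext => h; exact: fphi.
rewrite e12 e2 pV in e1.
exact: esym e1.
Qed.

Lemma left_gram_preserved (B : 'M[R]_m) (B' : 'M[R]_n) (f : G -> G') :
  smooth f ->
  (forall p, exists phi : G -> G', [/\ smooth phi, phi 1%g = 1%g,
     (forall h, (f p)^-1 * f h = phi (p^-1 * h))%g &
     tangent_mx c0 c0' phi 1%g *m B' *m (tangent_mx c0 c0' phi 1%g)^T = B]) ->
  preserves_inner (left_gram c0 B) (left_gram c0' B') f.
Proof.
move=> fs H p c d cp dp v w; have [phi [phis phi1 fphi <-]] := H p.
have e := tangent_maurer_cartan fs phis phi1 fphi cp dp.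
have eu (u : 'rV[R]_m) : tangent_map c d f p u *m maurer_cartan c0' d (f p) =
    u *m maurer_cartan c0 c p *m tangent_mx c0 c0' phi 1%g.
  by rewrite -mul_tangent_mx -mulmxA e mulmxA.
by rewrite !inner_left_gram !eu !trmx_mul !mulmxA.
Qed.

End Equivariance.

(** * Bi-invariant metrics *)

Section LeftInvariantMetric.
Variables (R : realType) (n : nat) (G : lieGroupType R n) (c0 : chart R n G).
Hypothesis c01 : chart_at (1%g : G) c0.
Variable B : 'M[R]_n.
Hypothesis symB : B^T = B.
Hypothesis posB : forall v, v != 0 -> 0 < qform B v.

Lemma left_gram_posdef (p : G) c : chart_at p c ->
  forall v, v != 0 -> 0 < inner (left_gram c0 B) c p v v.
Proof.
move=> cp v v0; rewrite inner_left_gram; apply: posB.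
apply: contraNN v0 => /eqP v0; have u := maurer_cartan_unit c01 cp.
by rewrite -(mulmxK u v) v0 mul0mx.
Qed.

Lemma left_gram_sym (p : G) c : chart_at p c ->
  forall v w, inner (left_gram c0 B) c p v w = inner (left_gram c0 B) c p w v.
Proof.
move=> cp v w; rewrite !inner_left_gram.
move: (v *m _) (w *m _) => x y.
have -> : x *m B *m y^T = (y *m B *m x^T)^T.
  by rewrite !trmx_mul trmxK symB mulmxA.
by rewrite mxE.
Qed.

Lemma left_gram_change_of_chart :
  preserves_inner (left_gram c0 B) (left_gram c0 B) (@id G).
Proof.
apply: (left_gram_preserved c01 c01); first exact: smooth_id.
move=> p; exists id; split => //; first exact: smooth_id.
by rewrite (tangent_mx_id c01) mul1mx trmx1 mulmx1.
Qed.

Definition left_metric : riemannianMetric G :=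
  RiemannianMetric left_gram_change_of_chart left_gram_sym left_gram_posdef
    (left_gram_smooth c01 B).

Lemma left_metric_left_mul (g : G) :
  Defs.isometry left_metric left_metric (fun h : G => g * h)%g.
Proof.
split; first exact: diffeomorphism_left_mul.
apply: (left_gram_preserved c01 c01); first exact: smooth_left_mul.
move=> p; exists id; split => //; first exact: smooth_id.
- by move=> h; rewrite invgM -mulgA (mulgA g^-1)%g mulVg mul1g.
- by rewrite (tangent_mx_id c01) mul1mx trmx1 mulmx1.
Qed.

(** At [p], right translation by [g] is left-equivariant along the conjugation
    by [g^-1], whence the invariance of [B] under the adjoint action. *)
Lemma left_metric_right_mul :
  (forall g, congruence (tangent_mx c0 c0 (fun h => conj_twist id (g, h)) 1%g) B = B) ->
  forall g : G, Defs.isometry left_metric left_metric (fun h : G => h * g)%g.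
Proof.
move=> HB g; split; first exact: diffeomorphism_right_mul.
apply: (left_gram_preserved c01 c01); first exact: smooth_right_mul.
move=> p; exists (fun h => conj_twist id (g^-1, h))%g; split.
- by apply: smooth_conj_twist_slice; exact: smooth_id.
- by rewrite /conj_twist /= mulg1 invgK mulVg.
- by move=> h; rewrite /conj_twist /= invgK invgM !mulgA.
- exact: HB.
Qed.

Lemma left_metric_hom (phi : G -> G) : smooth phi ->
  {morph phi : g h / (g * h)%g} -> involutive phi ->
  congruence (tangent_mx c0 c0 phi 1%g) B = B ->
  Defs.isometry left_metric left_metric phi.
Proof.
move=> phis phiM phiK HB; split; first by split=> //; exists phi.
have phi1 : phi 1%g = 1%g.
  by apply: (@mulgI _ (phi 1%g)); rewrite -phiM !mulg1.
have phiV p : phi (p^-1)%g = ((phi p)^-1)%g.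
  by apply: (@mulgI _ (phi p)); rewrite -phiM !mulgV.
apply: (left_gram_preserved c01 c01) => // p; exists phi; split=> //.
by move=> h; rewrite phiM phiV.
Qed.

End LeftInvariantMetric.

Section AdInvariantForm.
Variables (R : realType) (n : nat) (G : lieGroupType R n).
Hypothesis cptG : compact (@setT G).
Variables (c0 : chart R n G) (phi : G -> G).
Hypothesis c01 : chart_at (1%g : G) c0.
Hypothesis phis : smooth phi.
Hypothesis phiM : {morph phi : g h / (g * h)%g}.
Hypothesis phiK : involutive phi.

Let twist (b : bool) (h : G) : G := if b then phi h else h.

Let twist_smooth b : smooth (twist b).
Proof. by case: b => //; exact: smooth_id. Qed.

Let twistM b : {morph twist b : g h / (g * h)%g}.
Proof. by case: b => g h //=; exact: phiM. Qed.

Let twist1 b : twist b 1%g = 1%g.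
Proof. by apply: (@mulgI _ (twist b 1%g)); rewrite -twistM !mulg1. Qed.

Let twistV b p : twist b (p^-1)%g = ((twist b p)^-1)%g.
Proof. by apply: (@mulgI _ (twist b p)); rewrite -twistM !mulgV twist1. Qed.

Let twist_twist b b' h : twist b (twist b' h) = twist (b (+) b') h.
Proof. by case: b; case: b' => //=; rewrite phiK. Qed.

Let f b g (h : G) := conj_twist (twist b) (g, h).

Let f1 b g : f b g 1%g = 1%g.
Proof. by rewrite /f /conj_twist /= twist1 mulg1 mulgV. Qed.

Let f_smooth b g : smooth (f b g).
Proof. exact: smooth_conj_twist_slice. Qed.

Let T b g := tangent_mx c0 c0 (f b g) 1%g.

Let T_mul b g b' g' : T b g *m T b' g' = T (b' (+) b) (g' * twist b' g)%g.
Proof.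
have d1 : chart_at (f b g 1%g) c0 by rewrite f1.
have d2 : chart_at (f b' g' (f b g 1%g)) c0 by rewrite !f1.
have e := tangent_mx_comp (f_smooth b g) (f_smooth b' g') c01 d1 d2.
rewrite f1 in e; rewrite /T -e; congr (tangent_mx _ _ _ _).
apply/funext => h; rewrite /f /conj_twist /= !twistM twistV twist_twist.
by rewrite invgM !mulgA.
Qed.

Let T_id : T false 1%g = 1%:M.
Proof.
rewrite -(tangent_mx_id c01); congr (tangent_mx _ _ _ _).
by apply/funext => h; rewrite /f /conj_twist /= mul1g invg1 mulg1.
Qed.

(** The involution is put into the group of matrices by letting [phi] twist the
    conjugations: the maps [f b g] are closed under composition and inversion,
    see [T_mul]. *)
Lemma exists_ad_invariant_form : exists B : 'M[R]_n,
  [/\ B^T = B, forall v, v != 0 -> 0 < qform B v,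
      forall g, congruence (tangent_mx c0 c0 (fun h => conj_twist id (g, h)) 1%g) B = B &
      congruence (tangent_mx c0 c0 phi 1%g) B = B].
Proof.
have bounded b : exists C, forall g i j, `|T b g i j| <= C.
  apply: (bounded_tangent_family cptG c01
    (smooth_conj_twist (twist_smooth b))) => g.
  exact: f1.
have [C0 HC0] := bounded false; have [C1 HC1] := bounded true.
pose H : set 'M[R]_n := [set M | exists b g, M = T b g].
have [||||B [symB posB HB]] := @exists_invariant_form R n H _ _ _ (Num.max C0 C1).
- by exists false, 1%g.
- move=> _ _ [b [g ->]] [b' [g' ->]].
  by exists (b' (+) b), (g' * twist b' g)%g; exact: T_mul.
- move=> _ [b [g ->]]; exists (T b (twist b g^-1)%g).
    by exists b, (twist b g^-1)%g.
  by rewrite T_mul addbb -twistM mulVg twist1 T_id.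
- move=> _ [[] [g ->]] i j; rewrite le_max; apply/orP; [right|left].
    exact: HC1.
  exact: HC0.
exists B; split=> //; first by move=> g; apply: HB; exists false, g.
apply: HB; exists true, 1%g; congr (tangent_mx _ _ _ _).
by apply/funext => h; rewrite /f /conj_twist /= mul1g invg1 mulg1.
Qed.

End AdInvariantForm.

Section Submersions.
Variables (R : realType) (m n : nat).

(** The Maurer-Cartan forms identify the differential of [s] at [p] with its
    differential [A] at [1], horizontal vectors included, so it is enough that
    [A] be isometric on horizontal vectors. *)
Lemma left_metric_submersion (G : lieGroupType R m) (G' : lieGroupType R n)
    (c0 : chart R m G) (c0' : chart R n G')
    (c01 : chart_at (1%g : G) c0) (c01' : chart_at (1%g : G') c0')
    (B : 'M[R]_m) (symB : B^T = B)
    (posB : forall v, v != 0 -> 0 < qform B v)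
    (B' : 'M[R]_n) (symB' : B'^T = B')
    (posB' : forall v, v != 0 -> 0 < qform B' v) (s : G -> G') :
  submersion s -> {morph s : x y / (x * y)%g} ->
  let A := tangent_mx c0 c0' s 1%g in
  (forall v w : 'rV_m,
    (forall k : 'rV_m, k *m A = 0 -> (v *m B *m k^T) 0 0 = 0) ->
    (v *m B *m w^T) 0 0 = (v *m A *m B' *m (w *m A)^T) 0 0) ->
  riemannian_submersion (left_metric c01 symB posB)
    (left_metric c01' symB' posB') s.
Proof.
move=> sub sM A HA; split=> // p c d cp dp v w vh _.
have s1 : s 1%g = 1%g.
  by apply: (@mulgI _ (s 1%g)); rewrite -sM !mulg1.
have sV x : s (x^-1)%g = ((s x)^-1)%g.
  by apply: (@mulgI _ (s x)); rewrite -sM !mulgV.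
have sp h : ((s p)^-1 * s h = s (p^-1 * h))%g by rewrite sM sV.
have e := tangent_maurer_cartan c01 c01' sub.1 sub.1 s1 sp cp dp.
have eu (u : 'rV[R]_m) : tangent_map c d s p u *m maurer_cartan c0' d (s p) =
    u *m maurer_cartan c0 c p *m A.
  by rewrite -mul_tangent_mx -mulmxA e mulmxA.
have uG := maurer_cartan_unit c01 cp; have uG' := maurer_cartan_unit c01' dp.
rewrite !inner_left_gram !eu; apply: HA => k kA.
have := vh (k *m invmx (maurer_cartan c0 c p)).
rewrite inner_left_gram mulmxKV//; apply.
have := eu (k *m invmx (maurer_cartan c0 c p)); rewrite mulmxKV// kA => e0.
by rewrite -(mulmxK uG' (tangent_map _ _ _ _ _)) e0 mul0mx.
Qed.

(** [f] maps the kernel of the differential of [s o f] at [p] onto the kernel of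
    the differential of [s] at [f p]; surjectivity is where the inverse of [f]
    is used. *)
Lemma riemannian_submersion_comp_isometry (M : manifoldType R m)
    (N : manifoldType R n) (g : riemannianMetric M) (h : riemannianMetric N)
    (f : M -> M) (s : M -> N) :
  Defs.isometry g g f -> involutive f -> riemannian_submersion g h s ->
  submersion (s \o f) -> riemannian_submersion g h (s \o f).
Proof.
move=> [[fs _] fg] fK [ssub sh] sfsub; split=> // p c d cp dp v w vh wh.
have [e ep] := exists_chart_at (f p).
have ss := ssub.1.
have comp u : tangent_map c d (s \o f) p u =
    tangent_map e d s (f p) (tangent_map c e f p u).
  by rewrite -!mul_tangent_mx (tangent_mx_comp fs ss cp ep dp) mulmxA.
have ffp : chart_at (f (f p)) c by rewrite fK.
have ff : tangent_mx e c f (f p) *m tangent_mx c e f p = 1%:M.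
  have ep3 : chart_at (f (f (f p))) e by rewrite fK.
  have := tangent_mx_comp fs fs ep ffp ep3.
  have -> : f \o f = id by apply/funext => x; exact: fK.
  by rewrite fK (tangent_mx_id ep) => ->.
have lift u : horizontal g c d (s \o f) p u ->
    horizontal g e d s (f p) (tangent_map c e f p u).
  move=> uh k k0; pose k' := k *m tangent_mx e c f (f p).
  have kE : tangent_map c e f p k' = k.
    by rewrite -mul_tangent_mx /k' -mulmxA ff mulmx1.
  rewrite -{1}kE -(fg p c e cp ep); apply: uh.
  by rewrite comp kE.
rewrite (fg p c e cp ep) !comp.
exact: (sh (f p) e d ep dp _ _ (lift v vh) (lift w wh)).
Qed.

End Submersions.

(** Associativity applied to [i (i g)], [i g] and [g]. *)
Lemma lg_invK (R : realType) (n1 n0 : nat) (X1 : manifoldType R n1)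
    (X0 : manifoldType R n0) (X : lieGroupoid X1 X0) : involutive (lg_inv X).
Proof.
move=> g; set h := lg_inv X g; set k := lg_inv X h.
have sh : lg_src X h = lg_tgt X g by rewrite lg_src_inv.
have th : lg_tgt X h = lg_src X g by rewrite lg_tgt_inv.
have sk : lg_src X k = lg_tgt X h by rewrite lg_src_inv.
have tk : lg_tgt X k = lg_src X h by rewrite lg_tgt_inv.
have := lg_compA sk sh; rewrite !lg_inv_comp.
have -> : lg_src X g = lg_src X k by rewrite sk th.
by rewrite lg_comp_unit sh lg_unit_comp.
Qed.

Unset Implicit Arguments.

Theorem corollary3p19 (R : realType) (n1 n0 : nat)
    (G1 : lieGroupType R n1) (G0 : lieGroupType R n0) (X : lie2Group G1 G0)
    (connG1 : connected (@setT G1)) (connG0 : connected (@setT G0))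
    (cptG1 : compact (@setT G1)) :
  exists eta : oneMetric X, bi_invariant eta.
Proof.
have [c1 c11] := exists_chart_at (1%g : G1).
have [c0 c01] := exists_chart_at (1%g : G0).
have iK := lg_invK X; have iM := l2_invM X.
have [B [symB posB adB iB]] :=
  exists_ad_invariant_form cptG1 c11 (lg_inv_smooth X) iM iK.
pose A := tangent_mx c1 c0 (lg_src X) 1%g.
have s1 : lg_src X 1%g = 1%g.
  by apply: (@mulgI _ (lg_src X 1%g)); rewrite -l2_srcM !mulg1.
have surjA (w : 'rV[R]_n0) : exists v, v *m A = w.
  have s1c0 : chart_at (lg_src X 1%g) c0 by rewrite s1.
  have [v vw] := (lg_src_submersion X).2 1%g c1 c0 c11 s1c0 w.
  by exists v; rewrite mul_tangent_mx.
have [B0 [symB0 posB0 AB]] := exists_quotient_form symB posB surjA.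
pose g1 := left_metric c11 symB posB; pose g0 := left_metric c01 symB0 posB0.
have i_isom : Defs.isometry g1 g1 (lg_inv X).
  exact: left_metric_hom (lg_inv_smooth X) iM iK iB.
have s_sub : riemannian_submersion g1 g0 (lg_src X).
  exact: (left_metric_submersion c11 c01 _ _ _ _ (lg_src_submersion X)
    (l2_srcM X) AB).
have tE : lg_tgt X = lg_src X \o lg_inv X.
  by apply/funext => g; rewrite /= lg_src_inv.
have t_sub : riemannian_submersion g1 g0 (lg_tgt X).
  have := lg_tgt_submersion X; rewrite tE.
  exact: riemannian_submersion_comp_isometry.
exists (OneMetric i_isom s_sub t_sub); split=> g /=.
  exact: left_metric_left_mul.
exact: left_metric_right_mul.
Qed.
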